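(* Let $\sigma>0$, $c>0$ and $B\ge0$. Let $\{\theta^n\}_{n=1}^\infty$ be any sequence of vectors with $\theta^n\in\mathbb R^n$ and $\|\theta^n\|^2/n\le c^2$ for every $n$. For each $n$ let $X^n\sim\mathcal N(\theta^n,\sigma^2I_n)$ and let $M_n\in\mathcal M^*_{n,B,\sigma,c}$ be the random quantized estimator described in the context, with random codebook independent of $X^n$. Then there is a constant $C'$ not depending on $n$ such that, as $n\to\infty$, $$\mathbb P\left(d(\theta^n,M_n(X^n))>\frac{\sigma^2c^2}{\sigma^2+c^2}+\frac{c^4}{\sigma^2+c^2}2^{-2B}+C'\sqrt{\frac{\log n}{n}}\right)\longrightarrow 0,$$ where the probability is with respect to both the random codebook defining $M_n$ and $X^n$.
   Context: For $u,v\in\mathbb R^n$, $d(u,v)=\frac1n\|u-v\|^2$, with $\|\cdot\|$ the Euclidean norm. The random quantized estimator $M_n\in\mathcal M^*_{n,B,\sigma,c}$ is defined as follows. (1) Codebooks: $\mathcal B=\{1/\sqrt n,2/\sqrt n,\dots,\lceil c^2\sqrt n\rceil/\sqrt n\}$, and $\mathcal X$ consists of $2^{nB}$ (integer part, if not an integer) i.i.d. random vectors uniformly distributed on the unit sphere $\mathbb S^{n-1}\subset\mathbb R^n$. (2) Encoding: put $\hat b^2=\frac1n\|X^n\|^2-\sigma^2$ (a real number, possibly negative); let $\check b^2$ be the element of $\mathcal B$ minimizing $|\beta-\hat b^2|$ over $\beta\in\mathcal B$, and let $\check X^n$ be the element of $\mathcal X$ maximizing $\langle X^n,x^n\rangle$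 over $x^n\in\mathcal X$ (ties broken arbitrarily). The indices of these elements are stored or transmitted. (3) Decoding: the estimate is $$M_n(X^n)=\check\theta^n=\sqrt{\frac{n\,\check b^4(1-2^{-2B})}{\check b^2+\sigma^2}}\;\check X^n,\qquad \check b^4=(\check b^2)^2.$$ $\mathcal M^*_{n,B,\sigma,c}$ denotes the ensemble of such quantizers, identified with the set of possible codebooks $(\mathbb S^{n-1})^{2^{nB}}$ and given the product uniform probability measure. *)

(* Defs.v *)
From HB Require Import structures.
From mathcomp Require Import all_boot all_order all_algebra.
From mathcomp Require Import all_classical all_reals all_analysis.

Set Implicit Arguments.
Unset Strict Implicit.
Unset Printing Implicit Defensive.

Import Order.TTheory GRing.Theory Num.Theory.
Import numFieldNormedType.Exports.

Local Open Scope classical_set_scope.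
Local Open Scope ring_scope.

(* R^n is [n.-tuple R]: the library equips it with the product Borel
   sigma-algebra, whereas the canonical norm of ['rV[R]_n] is the sup norm. *)

Definition dotprod (R : realType) (n : nat) (u v : n.-tuple R) : R :=
  \sum_(i < n) tnth u i * tnth v i.

Definition enorm (R : realType) (n : nat) (u : n.-tuple R) : R :=
  Num.sqrt (\sum_(i < n) tnth u i ^+ 2).

Definition distortion (R : realType) (n : nat) (u v : n.-tuple R) : R :=
  n%:R^-1 * enorm [tuple tnth u i - tnth v i | i < n] ^+ 2.

Definition usphere (R : realType) (n : nat) : set (n.-tuple R) :=
  [set u | enorm u = 1].

Definition mxact (R : realType) (n : nat) (Q : 'M[R]_n) (u : n.-tuple R) :
    n.-tuple R :=
  [tuple \sum_(j < n) Q i j * tnth u j | i < n].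

(* The uniform distribution on the unit sphere: the Borel probability measure
   carried by the sphere and invariant under the whole orthogonal group O(n)
   (for n = 1 this is the fair sign; SO(n) would not be enough there). *)
Definition uniform_sphere (R : realType) (n : nat)
    (mu : probability (n.-tuple R) R) : Prop :=
  mu (@usphere R n) = 1%E /\
  forall Q : 'M[R]_n, Q *m Q^T = 1%:M ->
  forall A : set (n.-tuple R), measurable A -> mu (mxact Q @^-1` A) = mu A.

(* [nu] is the product measure of the [m i] on [n.-tuple S]; the boxes form a
   pi-system generating the sigma-algebra of [n.-tuple S]. *)
Definition product_law (R : realType) (d : measure_display)
    (S : measurableType d) (n : nat) (nu : set (n.-tuple S) -> \bar R)
    (m : 'I_n -> set S -> \bar R) : Prop :=
  forall A : 'I_n -> set S, (forall i, measurable (A i)) ->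
  nu [set x | forall i, A i (tnth x i)] = (\prod_(i < n) m i (A i))%E.

Definition independent_rv (R : realType) (d d1 d2 : measure_display)
    (T : measurableType d) (S1 : measurableType d1) (S2 : measurableType d2)
    (P : probability T R) (X : {mfun T >-> S1}) (Y : {mfun T >-> S2}) : Prop :=
  forall (A : set S1) (B : set S2), measurable A -> measurable B ->
  P (X @^-1` A `&` Y @^-1` B) = (P (X @^-1` A) * P (Y @^-1` B))%E.

(* X ~ N(theta, sigma^2 I_n); the second parameter of [normal_prob] is the
   standard deviation. *)
Definition isotropic_gaussian (R : realType) (d : measure_display)
    (T : measurableType d) (P : probability T R) (n : nat)
    (theta : n.-tuple R) (sigma : R) (X : {mfun T >-> n.-tuple R}) : Prop :=
  product_law (distribution P X) (fun i => normal_prob (tnth theta i) sigma).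

Definition codebook_size (R : realType) (n : nat) (B : R) : nat :=
  Num.truncn (2 `^ (n%:R * B)).

Definition uniform_codebook (R : realType) (d : measure_display)
    (T : measurableType d) (P : probability T R) (n N : nat)
    (U : {mfun T >-> N.-tuple (n.-tuple R)}) : Prop :=
  exists2 mu : probability (n.-tuple R) R,
    uniform_sphere mu & product_law (distribution P U) (fun=> mu).

Definition magnitude_codebook (R : realType) (n : nat) (c : R) : set R :=
  [set beta | exists k : nat,
    [/\ (1 <= k)%N, k%:Z <= Num.ceil (c ^+ 2 * Num.sqrt n%:R)
      & beta = k%:R / Num.sqrt n%:R]].

Definition is_argmin (R : realType) (I : Type) (S : set I) (f : I -> R)
    (a : I) : Prop :=
  S a /\ forall a', S a' -> f a <= f a'.

Definition is_argmax (R : realType) (I : Type) (S : set I) (f : I -> R)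
    (a : I) : Prop :=
  S a /\ forall a', S a' -> f a' <= f a.

(* [b] and [xc] stand for the squared magnitude and the codeword selected by
   the encoder. *)
Definition decode_estimate (R : realType) (n : nat) (sigma B b : R)
    (xc : n.-tuple R) : n.-tuple R :=
  [tuple Num.sqrt (n%:R * b ^+ 2 * (1 - 2 `^ (- 2 * B)) / (b + sigma ^+ 2))
         * tnth xc i | i < n].

(* [m] is an estimate produced from the data [x] with the codebook [C], for
   some way of breaking the ties. *)
Definition quantized_estimate (R : realType) (n N : nat) (sigma c B : R)
    (C : N.-tuple (n.-tuple R)) (x m : n.-tuple R) : Prop :=
  exists (b : R) (xc : n.-tuple R),
    [/\ is_argmin (magnitude_codebook n c)
          (fun beta => `|beta - (n%:R^-1 * enorm x ^+ 2 - sigma ^+ 2)|) b,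
        is_argmax [set y | y \in C] (dotprod x) xc
      & m = decode_estimate sigma B b xc].

(* Main.v *)
(** The conditional law of the chosen codeword is never computed: it suffices
    that, for fixed data [x], with high probability some codeword has cosine at
    least [t] with [x], while no codeword with this property has a component
    below [- delta] along the part of [theta] orthogonal to [x].  Both events
    are controlled by masses of spherical caps: a unit vector with component at
    least [t] along [x] and at most [- delta] along an orthogonal direction lies
    in the cap of height [sqrt (t^2 + delta^2)] of an intermediate direction.
    With [q = 2^(-2B)], [t^2 = 1 - q - 12 q log n / n] and
    [delta^2 = 25 log n / n], a union bound over the [q^(-n/2)] codewords
    suffices.

    The mass of the cap of height [t] is [(1 - t^2)^(n/2)] up to polynomial
    factors.  This follows from the integration by parts formula
    [E ((1 - y_i^2) f'(y_i)) = (n - 1) E (y_i f(y_i))], which is the first-order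
    term of the invariance of the uniform measure under reflections that are
    close to the reflection of a coordinate axis, by choosing [f] well.

    The magnitude and the inner product of [theta] with the data are controlled
    by Chebyshev's inequality, so that every probability involved is
    [O(1 / log n)]. *)

Require Import Defs.
From HB Require Import structures.
From mathcomp Require Import all_boot all_order all_algebra.
From mathcomp Require Import all_classical all_reals all_analysis.
From mathcomp Require Import measurable_realfun zify ring lra.

Set Implicit Arguments.
Unset Strict Implicit.
Unset Printing Implicit Defensive.

Import Order.TTheory GRing.Theory Num.Theory.
Import numFieldNormedType.Exports.

Local Open Scope classical_set_scope.
Local Open Scope ring_scope.

(** * Reflections and the unit sphere *)

(** The uniform law on the sphere is given only by its invariance, so there is no density of a
    coordinate from which cap masses could be read off. Both cap bounds come from one identity with
    two test functions: [x] times a power of [1 / (tau - x^2)] for the upper bound, combined with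
    Markov's inequality, and a regularised [- x / (1 - x^2)^j] for the lower one. Each bound loses a
    power of [n], and the constants 12 and 25 pay for it. The factor [1 + 12 log n / n] in [1 - t^2]
    gains [n^3] against the [n^2] lost in the lower bound; [delta^2] is large enough for
    [1 - t^2 - delta^2] to stay below [q (1 - 8 log n / n)], which gains [n^(-2)] against the factor
    [n] of the upper bound. A one-sided deviation is enough, because the distortion depends on a
    unit codeword [y] only through [- 2 w <theta, y>] with [w >= 0]. The rate [sqrt (log n / n)] of
    the theorem is the size of [delta], and also the size of the fluctuations allowed to the
    data. *)

Section sphere_geometry.
Variable R : realType.
Implicit Types (n : nat).

Lemma dotprodC n (u v : n.-tuple R) : dotprod u v = dotprod v u.
Proof. by apply: eq_bigr => i _; rewrite mulrC. Qed.

Lemma enorm_sqr n (u : n.-tuple R) : enorm u ^+ 2 = dotprod u u.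
Proof.
rewrite sqr_sqrtr; last by apply: sumr_ge0 => i _; exact: sqr_ge0.
by apply: eq_bigr => i _; rewrite expr2.
Qed.

Lemma dotprod_ge0 n (u : n.-tuple R) : 0 <= dotprod u u.
Proof. by rewrite -enorm_sqr sqr_ge0. Qed.

Lemma usphereE n (u : n.-tuple R) : usphere u <-> dotprod u u = 1.
Proof.
rewrite -enorm_sqr; split=> [->|/eqP]; first by rewrite expr1n.
by rewrite sqrp_eq1 ?sqrtr_ge0// => /eqP.
Qed.

Lemma sum_sqr_usphere n (u : n.-tuple R) : usphere u ->
  \sum_(i < n) tnth u i ^+ 2 = 1.
Proof.
by move=> /usphereE <-; apply: eq_bigr => i _; rewrite expr2.
Qed.

Lemma usphere_tnth_le1 n (u : n.-tuple R) i : usphere u -> `|tnth u i| <= 1.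
Proof.
move=> /sum_sqr_usphere; rewrite (bigD1 i)//= => u1.
have : tnth u i ^+ 2 <= 1.
  by rewrite -u1 lerDl; apply: sumr_ge0 => j _; exact: sqr_ge0.
by rewrite -real_normK ?num_real// expr_le1.
Qed.

Lemma dotprodBl n (u v w : n.-tuple R) (a : R) :
  dotprod [tuple tnth u i - a * tnth v i | i < n] w =
  dotprod u w - a * dotprod v w.
Proof.
rewrite /dotprod mulr_sumr -sumrB; apply: eq_bigr => i _.
by rewrite tnth_mktuple mulrBl mulrA.
Qed.

Lemma cauchy_schwarz n (u v : n.-tuple R) :
  dotprod u v ^+ 2 <= dotprod u u * dotprod v v.
Proof.
have [v0|v0] := eqVneq (dotprod v v) 0.
  suff -> : dotprod u v = 0 by rewrite v0 mulr0 expr0n.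
  rewrite /dotprod big1// => i _; apply/eqP; rewrite mulf_eq0; apply/orP; right.
  have := v0; rewrite /dotprod => /eqP; rewrite psumr_eq0; last first.
    by move=> j _; rewrite -expr2 sqr_ge0.
  by move=> /allP/(_ i (mem_index_enum _))/=; rewrite mulf_eq0 orbb.
have vp : 0 < dotprod v v by rewrite lt_neqAle eq_sym v0 dotprod_ge0.
have := dotprod_ge0
  [tuple tnth u i - (dotprod u v / dotprod v v) * tnth v i | i < n].
rewrite dotprodBl ![dotprod _ (mktuple _)]dotprodC !dotprodBl (dotprodC v u).
set p := dotprod u v; set q := dotprod v v; set r := dotprod u u => h.
suff : 0 <= (r * q - p ^+ 2) / q by rewrite pmulr_lge0 ?invr_gt0// subr_ge0.
suff -> : (r * q - p ^+ 2) / q =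
  r - p / q * p - p / q * (p - p / q * q) by [].
by field; rewrite v0.
Qed.

Definition reflection n (v : n.-tuple R) : 'M[R]_n :=
  1%:M - (2 / dotprod v v) *: (\matrix_(i, j) (tnth v i * tnth v j)).

Lemma mxact_reflection n (v y : n.-tuple R) i :
  tnth (mxact (reflection v) y) i =
  tnth y i - 2 / dotprod v v * dotprod v y * tnth v i.
Proof.
rewrite tnth_mktuple.
under eq_bigr do rewrite !mxE mulrBl.
rewrite sumrB; congr (_ - _).
  rewrite (bigD1 i)//= eqxx mul1r big1 ?addr0// => j ij.
  by rewrite eq_sym (negbTE ij) mul0r.
set k := 2 / _; rewrite mulrAC [RHS]mulr_sumr; apply: eq_bigr => j _.
by ring.
Qed.

Lemma reflection_orthogonal n (v : n.-tuple R) : dotprod v v != 0 ->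
  reflection v *m (reflection v)^T = 1%:M.
Proof.
move=> v0; rewrite /reflection.
set V := \matrix_(i, j) _.
have VV : V *m V = dotprod v v *: V.
  apply/matrixP => i j; rewrite !mxE mulr_suml.
  by apply: eq_bigr => k _; rewrite !mxE; ring.
set k := 2 / _; have -> : (1%:M - k *: V)^T = 1%:M - k *: V.
  by apply/matrixP => i j; rewrite !mxE eq_sym (mulrC (tnth v j)).
rewrite mulmxBl !mulmxBr !mulmx1 mul1mx -!scalemxAl -!scalemxAr VV !scalerA.
rewrite (_ : k * k * _ = k + k); last by rewrite /k; field.
by rewrite scalerDl opprB addrK subrK.
Qed.

Lemma mxact_usphere n (Q : 'M[R]_n) (y : n.-tuple R) :
  Q *m Q^T = 1%:M -> usphere (mxact Q y) <-> usphere y.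
Proof.
move=> /mulmx1C QQ; rewrite !usphereE.
suff -> : dotprod (mxact Q y) (mxact Q y) = dotprod y y by [].
pose c : 'cV[R]_n := \col_i tnth y i.
have dE (z : n.-tuple R) :
    dotprod z z = ((\col_i tnth z i)^T *m (\col_i tnth z i)) 0 0.
  by rewrite mxE; apply: eq_bigr => i _; rewrite !mxE.
have -> : dotprod (mxact Q y) (mxact Q y) = ((Q *m c)^T *m (Q *m c)) 0 0.
  rewrite dE; congr ((_^T *m _) _ _); apply/matrixP => i j;
  by rewrite !mxE tnth_mktuple; apply: eq_bigr => k _; rewrite mxE.
by rewrite trmx_mul -mulmxA (mulmxA Q^T) QQ mul1mx dE.
Qed.

Lemma measurable_dotprod (d : measure_display) (T : measurableType d) n
    (f g : T -> n.-tuple R) :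
  measurable_fun setT f -> measurable_fun setT g ->
  measurable_fun setT (fun x => dotprod (f x) (g x)).
Proof.
move=> mf mg; apply: measurable_sum => i; apply: measurable_funM.
  exact: (measurableT_comp (measurable_tnth i) mf).
exact: (measurableT_comp (measurable_tnth i) mg).
Qed.

Lemma measurable_usphere n : measurable (@usphere R n).
Proof.
rewrite (_ : usphere (n:=n) = (fun u => dotprod u u) @^-1` [set 1 : R]).
  rewrite -[_ @^-1` _]setTI; apply: measurable_dotprod => //.
by apply/funext => u /=; apply/propext; rewrite usphereE.
Qed.

Lemma measurable_mxact n (Q : 'M[R]_n) : measurable_fun setT (mxact Q).
Proof.
apply/measurable_fun_tnthP => i.
rewrite (_ : _ \o _ = fun u => \sum_(j < n) Q i j * tnth u j).
  apply: measurable_sum => j; apply: measurable_funM => //.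
  exact: measurable_tnth.
by apply/funext => u /=; rewrite tnth_mktuple.
Qed.

End sphere_geometry.

(** * Differentiable functions with a quadratic remainder *)

Section C11_functions.
Variable R : realType.
Implicit Types f g : R -> R.

(** [g] plays the role of the derivative of [f] on [-1, 1], where the coordinates of a unit vector
    live. Carrying the pair with an explicit quadratic remainder turns first-order expansions under
    the mean into plain estimates. Measurability is asked on the whole line, as integrands are
    functions on all of R^n. *)
Definition C11 f g := [/\ measurable_fun setT f, measurable_fun setT g &
  exists2 K : R, 0 <= K & forall x x', `|x| <= 1 -> `|x'| <= 1 ->
  [/\ `|f x| <= K, `|g x| <= K &
      `|f x' - f x - g x * (x' - x)| <= K * (x' - x) ^+ 2]].

Lemma eq_C11 f1 f2 g1 g2 : f1 =1 f2 -> g1 =1 g2 -> C11 f1 g1 -> C11 f2 g2.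
Proof. by move=> /funext-> /funext->. Qed.

Lemma C11_cst (a : R) : C11 (fun=> a) (fun=> 0).
Proof.
split => //; exists `|a| => // x x' _ _; split => //.
  by rewrite normr0.
by rewrite subrr mul0r subrr normr0 mulr_ge0// sqr_ge0.
Qed.

Lemma C11_id : C11 (fun x => x) (fun=> 1).
Proof.
split => //; exists 1 => // x x' x1 x'1; split => //.
  by rewrite normr1.
by rewrite mul1r subrr normr0 mul1r sqr_ge0.
Qed.

Lemma C11_common f1 g1 f2 g2 : C11 f1 g1 -> C11 f2 g2 ->
  exists2 K : R, 0 <= K & forall x x', `|x| <= 1 -> `|x'| <= 1 ->
  [/\ `|f1 x| <= K, `|g1 x| <= K &
      `|f1 x' - f1 x - g1 x * (x' - x)| <= K * (x' - x) ^+ 2] /\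
  [/\ `|f2 x| <= K, `|g2 x| <= K &
      `|f2 x' - f2 x - g2 x * (x' - x)| <= K * (x' - x) ^+ 2].
Proof.
move=> [_ _ [K1 K10 H1]] [_ _ [K2 K20 H2]].
exists (K1 + K2); first exact: addr_ge0.
move=> x x' x1 x'1; have [a b c] := H1 _ _ x1 x'1.
have [a' b' c'] := H2 _ _ x1 x'1; have := sqr_ge0 (x' - x) => h.
by split; split; rewrite ?mulrDl; nra.
Qed.

Lemma C11_add f1 g1 f2 g2 : C11 f1 g1 -> C11 f2 g2 ->
  C11 (fun x => f1 x + f2 x) (fun x => g1 x + g2 x).
Proof.
move=> H1 H2; have [K K0 H] := C11_common H1 H2.
case: H1 H2 => mf1 mg1 _ [mf2 mg2 _].
split; [exact: measurable_funD|exact: measurable_funD|].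
exists (K + K); first exact: addr_ge0.
move=> x x' x1 x'1; have [[a b c] [a' b' c']] := H _ _ x1 x'1; split.
- exact: le_trans (ler_normD _ _) (lerD a a').
- exact: le_trans (ler_normD _ _) (lerD b b').
- rewrite (_ : _ - _ = (f1 x' - f1 x - g1 x * (x' - x)) +
     (f2 x' - f2 x - g2 x * (x' - x))); last by ring.
  by rewrite mulrDl; exact: le_trans (ler_normD _ _) (lerD c c').
Qed.

Lemma ler_normM2 (a b A B : R) : `|a| <= A -> `|b| <= B -> `|a * b| <= A * B.
Proof. by move=> aA bB; rewrite normrM ler_pM. Qed.

Lemma sqr_sub_le4 (x x' : R) : `|x| <= 1 -> `|x'| <= 1 -> (x' - x) ^+ 2 <= 4.
Proof. by rewrite !ler_norml => /andP[? ?] /andP[? ?]; nra. Qed.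

Lemma C11_mul f1 g1 f2 g2 : C11 f1 g1 -> C11 f2 g2 ->
  C11 (fun x => f1 x * f2 x) (fun x => g1 x * f2 x + f1 x * g2 x).
Proof.
move=> H1 H2; have [K K0 H] := C11_common H1 H2.
case: H1 H2 => mf1 mg1 _ [mf2 mg2 _].
split; [exact: measurable_funM|apply: measurable_funD; exact: measurable_funM|].
(* With [h = x' - x] and remainders [r1], [r2], the remainder of the product is
   [r1 f2(x') + (f1(x') - r1) r2 + g1 g2 h^2]. Since [h^2 <= 4], [f1(x') - r1] is at most [5 K], and
   the three terms contribute 1, 5 and 1 times [K^2 h^2]. *)
exists (7 * K ^+ 2); first by rewrite mulr_ge0// sqr_ge0.
move=> x x' x1 x'1; have [[a b c] [a' b' c']] := H _ _ x1 x'1.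
have [[d _ _] [d' _ _]] := H _ _ x'1 x1; have K2 := sqr_ge0 K; split.
- by apply: le_trans (ler_normM2 a a') _; rewrite -expr2; nra.
- apply: le_trans (ler_normD _ _) _.
  by have := lerD (ler_normM2 b a') (ler_normM2 a b'); rewrite -expr2; nra.
- set h := x' - x in c c' *.
  set r1 := f1 x' - f1 x - g1 x * h in c *.
  set r2 := f2 x' - f2 x - g2 x * h in c' *.
  rewrite (_ : _ - _ = r1 * f2 x' + (f1 x' - r1) * r2 + g1 x * g2 x * h ^+ 2);
    last by rewrite /r1 /r2; ring.
  have h4 : h ^+ 2 <= 4 by exact: sqr_sub_le4.
  have hh : `|h ^+ 2| <= h ^+ 2 by rewrite ger0_norm ?sqr_ge0.
  have e : `|f1 x' - r1| <= 5 * K.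
    apply: le_trans (ler_normB _ _) _; apply: le_trans (lerD d c) _.
    by nra.
  apply: le_trans (ler_normD _ _) _.
  apply: le_trans (lerD (ler_normD _ _) (ler_normM2 (ler_normM2 b b') hh)) _.
  have := lerD (ler_normM2 c d') (ler_normM2 e c').
  rewrite (_ : 7 * K ^+ 2 * h ^+ 2 = K * h ^+ 2 * K + 5 * K * (K * h ^+ 2) +
    K * K * h ^+ 2); last by ring.
  by move=> ?; rewrite lerD2r.
Qed.

Lemma C11_exp f g n : C11 f g ->
  C11 (fun x => f x ^+ n) (fun x => n%:R * f x ^+ n.-1 * g x).
Proof.
move=> fg; elim: n => [|n IH].
  apply: eq_C11 (C11_cst 1); first by move=> x; rewrite expr0.
  by move=> x; rewrite !mul0r.
apply: eq_C11 (C11_mul fg IH); first by move=> x; rewrite exprS.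
move=> x /=; case: n {IH} => [|n] /=; first by rewrite expr0; ring.
by rewrite -!natr1 exprS; ring.
Qed.

(* [a `^ (-1)] is [a^-1] for [a >= 0] and, unlike [a^-1], is known to be
   measurable in [a]. *)
Lemma C11_inv f g eta : 0 < eta -> (forall x, `|x| <= 1 -> eta <= f x) ->
  C11 f g -> C11 (fun x => f x `^ (-1)) (fun x => - g x * (f x `^ (-1)) ^+ 2).
Proof.
move=> eta0 fe [mf mg [K K0 H]].
have mi : measurable_fun setT (fun x => f x `^ (-1)).
  exact: (measurableT_comp (measurable_powR (-1)) mf).
split => //.
  by apply: measurable_funM; [exact: measurable_funN|exact: measurable_funX].
have fpos x : `|x| <= 1 -> 0 < f x by move=> /fe; exact: lt_le_trans.
have invE x : `|x| <= 1 -> f x `^ (-1) = (f x)^-1.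
  by move=> /fpos /ltW fx; rewrite powR_inv1.
have e0 : 0 < eta^-1 by rewrite invr_gt0.
have Vf x : `|x| <= 1 -> `|(f x)^-1| <= eta^-1.
  move=> x1; have fx := fpos _ x1; rewrite ger0_norm ?invr_ge0; last exact: ltW.
  by rewrite lef_pV2 ?posrE// fe.
exists (eta^-1 + K * eta^-1 ^+ 2 + (5 * K ^+ 2 + K ^+ 2) * eta^-1 ^+ 3).
  by rewrite !addr_ge0// ?mulr_ge0// ?addr_ge0 ?mulr_ge0// ?sqr_ge0// ?exprn_ge0 ?ltW.
move=> x x' x1 x'1; have [a b c] := H _ _ x1 x'1.
have K1 : 0 <= K * eta^-1 ^+ 2 by rewrite mulr_ge0// sqr_ge0.
have K2 : 0 <= (5 * K ^+ 2 + K ^+ 2) * eta^-1 ^+ 3.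
  by rewrite mulr_ge0// ?addr_ge0 ?mulr_ge0// ?sqr_ge0// ?exprn_ge0 ?ltW.
rewrite !invE//; split.
- by apply: le_trans (Vf _ x1) _; rewrite -addrA lerDl addr_ge0.
- rewrite -normrN mulNr opprK.
  have := ler_normM2 b (ler_normM2 (Vf _ x1) (Vf _ x1)).
  rewrite -!expr2 => /le_trans; apply.
  by rewrite addrAC lerDr addr_ge0// ltW.
- set h := x' - x in c *; set r := f x' - f x - g x * h in c *.
  have f0 : f x != 0 by rewrite gt_eqF ?fpos.
  have f0' : f x' != 0 by rewrite gt_eqF ?fpos.
  rewrite (_ : _ - _ = (g x * g x * h ^+ 2 + (g x * h - f x) * r) *
      ((f x)^-1 * ((f x)^-1 * (f x')^-1))); last first.
    by rewrite /r; field; rewrite f0 f0'.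
  have h4 : h ^+ 2 <= 4 by exact: sqr_sub_le4.
  have hh : `|h ^+ 2| <= h ^+ 2 by rewrite ger0_norm ?sqr_ge0.
  have h2 : `|h| <= 2.
    by rewrite -ler_sqr ?nnegrE// real_normK ?num_real//; lra.
  have e : `|g x * h - f x| <= 3 * K.
    apply: le_trans (ler_normB _ _) _.
    by have := lerD (ler_normM2 b h2) a; lra.
  have E : `|g x * g x * h ^+ 2 + (g x * h - f x) * r| <= 4 * K ^+ 2 * h ^+ 2.
    apply: le_trans (ler_normD _ _) _.
    have := lerD (ler_normM2 (ler_normM2 b b) hh) (ler_normM2 e c).
    move=> /le_trans; apply.
    by rewrite le_eqVlt; apply/orP; left; apply/eqP; ring.
  have V3 := ler_normM2 (Vf _ x1) (ler_normM2 (Vf _ x1) (Vf _ x'1)).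
  have := ler_normM2 E V3 => /le_trans; apply.
  rewrite [leLHS](_ : _ = 4 * (K ^+ 2 * eta^-1 ^+ 3) * h ^+ 2); last by ring.
  have K3 : 0 <= K ^+ 2 * eta^-1 ^+ 3.
    by rewrite mulr_ge0// ?sqr_ge0// exprn_ge0// ltW.
  by rewrite ler_wpM2r ?sqr_ge0//; lra.
Qed.

End C11_functions.

(** * Means over the uniform measure of the sphere *)

Section sphere_expectation.
Variables (R : realType) (n : nat) (mu : probability (n.-tuple R) R).
Hypothesis mu_uniform : uniform_sphere mu.
Implicit Types f g : n.-tuple R -> R.

(** A condition sufficient for integrability over the sphere and stable under algebra and orthogonal
    maps, so that integrability follows from the shape of the integrand. *)
Definition sphere_bounded f := measurable_fun setT f /\
  exists K, forall y, usphere y -> `|f y| <= K.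

Lemma sphere_bounded_cst a : sphere_bounded (fun=> a).
Proof. by split => //; exists `|a|. Qed.

Lemma sphere_bounded_tnth i : sphere_bounded (fun y => tnth y i).
Proof.
split; first exact: measurable_tnth.
by exists 1 => y; exact: usphere_tnth_le1.
Qed.

Lemma sphere_boundedD f g : sphere_bounded f -> sphere_bounded g ->
  sphere_bounded (fun y => f y + g y).
Proof.
move=> [mf [K1 H1]] [mg [K2 H2]]; split; first exact: measurable_funD.
exists (K1 + K2) => y sy.
exact: le_trans (ler_normD _ _) (lerD (H1 _ sy) (H2 _ sy)).
Qed.

Lemma sphere_boundedM f g : sphere_bounded f -> sphere_bounded g ->
  sphere_bounded (fun y => f y * g y).
Proof.
move=> [mf [K1 H1]] [mg [K2 H2]]; split; first exact: measurable_funM.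
by exists (K1 * K2) => y sy; apply: ler_normM2; [exact: H1|exact: H2].
Qed.

Lemma sphere_boundedN f : sphere_bounded f -> sphere_bounded (fun y => - f y).
Proof.
move=> [mf [K H]]; split; first exact: measurable_funN.
by exists K => y sy; rewrite normrN H.
Qed.

Lemma sphere_boundedX f k : sphere_bounded f ->
  sphere_bounded (fun y => f y ^+ k).
Proof.
move=> fb; elim: k => [|k IH]; first exact: sphere_bounded_cst.
by under eq_fun do rewrite exprS; exact: sphere_boundedM.
Qed.

Lemma sphere_bounded_sum (I : Type) (s : seq I) (F : I -> n.-tuple R -> R) :
  (forall i, sphere_bounded (F i)) ->
  sphere_bounded (fun y => \sum_(i <- s) F i y).
Proof.
move=> FB; elim: s => [|i s IH].
  by under eq_fun do rewrite big_nil; exact: sphere_bounded_cst.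
by under eq_fun do rewrite big_cons; exact: sphere_boundedD.
Qed.

Lemma sphere_bounded_C11 (f g : R -> R) i : C11 f g ->
  sphere_bounded (fun y => f (tnth y i)) /\
  sphere_bounded (fun y => g (tnth y i)).
Proof.
move=> [mf mg [K _ H]]; split; split.
- exact: measurableT_comp mf (measurable_tnth i).
- exists K => y sy.
  by have [] := H _ _ (usphere_tnth_le1 i sy) (usphere_tnth_le1 i sy).
- exact: measurableT_comp mg (measurable_tnth i).
- exists K => y sy.
  by have [] := H _ _ (usphere_tnth_le1 i sy) (usphere_tnth_le1 i sy).
Qed.

Lemma sphere_bounded_indic (A : set (n.-tuple R)) : measurable A ->
  sphere_bounded (\1_A : n.-tuple R -> R).
Proof.
move=> mA; split; first exact: measurable_indic.
by exists 1 => y _; rewrite indicE; case: (_ \in _); rewrite ?normr1 ?normr0.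
Qed.

Lemma sphere_bounded_mxact (Q : 'M[R]_n) f : Q *m Q^T = 1%:M ->
  sphere_bounded f -> sphere_bounded (fun y => f (mxact Q y)).
Proof.
move=> QQ [mf [K H]]; split; first exact: measurableT_comp mf (measurable_mxact _).
by exists K => y sy; apply: H; apply/mxact_usphere.
Qed.

Lemma sphere_bounded_integrable f : sphere_bounded f ->
  mu.-integrable (@usphere R n) (EFin \o f).
Proof.
move=> [mf [K H]]; apply: measurable_bounded_integrable.
- exact: measurable_usphere.
- by rewrite ltey_eq fin_num_measure//; exact: measurable_usphere.
- exact: measurable_funTS.
- exists K; split; first exact: num_real.
  by move=> x Kx y sy; exact: le_trans (H _ sy) (ltW Kx).
Qed.

(** Restricting the integral to the sphere loses nothing, as [mu] is carried by it, and lets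
    integrands be compared there only. *)
Definition sphere_mean f := \int[mu]_(y in @usphere R n) f y.

Lemma sphere_meanD f g : sphere_bounded f -> sphere_bounded g ->
  sphere_mean (fun y => f y + g y) = sphere_mean f + sphere_mean g.
Proof.
move=> fb gb; apply: RintegralD; first exact: measurable_usphere.
  exact: sphere_bounded_integrable.
exact: sphere_bounded_integrable.
Qed.

Lemma sphere_meanZ a f : sphere_bounded f ->
  sphere_mean (fun y => a * f y) = a * sphere_mean f.
Proof.
move=> fb; apply: RintegralZl; first exact: measurable_usphere.
exact: sphere_bounded_integrable.
Qed.

Lemma sphere_mean_cst a : sphere_mean (fun=> a) = a.
Proof.
rewrite /sphere_mean Rintegral_cst; last exact: measurable_usphere.
have S1 : fine (mu (@usphere R n)) = 1 by case: mu_uniform => ->.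
by rewrite S1 mulr1.
Qed.

Lemma sphere_mean_sum (I : Type) (s : seq I) (F : I -> n.-tuple R -> R) :
  (forall i, sphere_bounded (F i)) ->
  sphere_mean (fun y => \sum_(i <- s) F i y) =
  \sum_(i <- s) sphere_mean (F i).
Proof.
move=> FB; elim: s => [|i s IH].
  by under eq_fun do rewrite big_nil; rewrite big_nil sphere_mean_cst.
under eq_fun do rewrite big_cons; rewrite sphere_meanD ?big_cons ?IH//.
exact: sphere_bounded_sum.
Qed.

Lemma eq_sphere_mean f g : (forall y, usphere y -> f y = g y) ->
  sphere_mean f = sphere_mean g.
Proof. by move=> fg; apply: eq_Rintegral => y; rewrite inE => /fg. Qed.

Lemma le_sphere_mean f g : sphere_bounded f -> sphere_bounded g ->
  (forall y, usphere y -> f y <= g y) -> sphere_mean f <= sphere_mean g.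
Proof.
move=> fb gb fg; apply: le_Rintegral => //; first exact: measurable_usphere.
  exact: sphere_bounded_integrable.
exact: sphere_bounded_integrable.
Qed.

Lemma sphere_mean_indic (A : set (n.-tuple R)) : measurable A ->
  ((sphere_mean \1_A)%:E = mu A)%E.
Proof.
move=> mA; rewrite /sphere_mean /Rintegral integral_indic//; last exact: measurable_usphere.
have mS := @measurable_usphere R n.
have <- : mu (A `&` @usphere R n) = mu A.
  have muC : mu (~` @usphere R n) = 0%E.
    rewrite probability_setC// [X in (_ - X)%E](_ : _ = 1%E) ?subee//.
    by case: mu_uniform.
  rewrite -[in RHS](setIT A) -(setUv (@usphere R n)) setIUr measureU//.
  - rewrite [X in (_ + X)%E](_ : _ = 0%E) ?adde0//.
    apply/eqP; rewrite eq_le measure_ge0 andbT -muC.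
    by apply: le_measure; rewrite ?inE//; [apply: measurableI => //|];
      exact: measurableC.
  - exact: measurableI.
  - by apply: measurableI => //; exact: measurableC.
  - by rewrite setIACA setICr setI0.
by rewrite -[RHS]fineK// fin_num_measure//; exact: measurableI.
Qed.

Lemma sphere_mean_mxact (Q : 'M[R]_n) f : Q *m Q^T = 1%:M ->
  sphere_bounded f -> sphere_mean (fun y => f (mxact Q y)) = sphere_mean f.
Proof.
move=> QQ fb; rewrite /sphere_mean /Rintegral; congr fine.
have sE : mxact Q @^-1` (@usphere R n) = @usphere R n.
  by apply/funext => y; apply/propext; exact: mxact_usphere.
have mQ := measurable_mxact Q.
have mS := @measurable_usphere R n.
rewrite -{1}sE -(@integral_pushforward _ _ _ _ _ _ mQ mu (@usphere R n) (EFin \o f))//.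
- apply: eq_measure_integral => A mA _.
  by rewrite /pushforward; case: mu_uniform => _; exact.
- by apply/measurable_EFinP; case: fb.
- rewrite sE; apply: (@sphere_bounded_integrable (f \o mxact Q)).
  exact: sphere_bounded_mxact.
Qed.

Lemma dotprod_axes (a : R) (y : n.-tuple R) (i j : 'I_n) : j != i ->
  dotprod [tuple a *+ (k == i) + (k == j)%:R | k < n] y =
  a * tnth y i + tnth y j.
Proof.
move=> ij; rewrite /dotprod (bigD1 i)//= (bigD1 j)//= big1 ?addr0.
  by rewrite !tnth_mktuple !eqxx (eq_sym i) (negbTE ij) /= mulr1n !mulr0n; ring.
move=> k /andP[/negbTE ki /negbTE kj].
by rewrite tnth_mktuple ki kj /= !mulr0n addr0 mul0r.
Qed.

(* Reflecting along [a e_i + e_j] maps the coordinates [(y_i, y_j)] to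
   [(y_i - 2 a y_j, - y_j - 2 a y_i)] up to [O(a^2)]; the identity is the
   first-order term in [a] of the invariance of the mean of [y_j f(y_i)]. *)
Lemma sphere_mean_reflection (f g : R -> R) (i j : 'I_n) : j != i -> C11 f g ->
  sphere_mean (fun y => tnth y j ^+ 2 * g (tnth y i) -
                        tnth y i * f (tnth y i)) = 0.
Proof.
move=> ij fg; have [fb gb] := sphere_bounded_C11 i fg.
have ib := sphere_bounded_tnth i; have jb := sphere_bounded_tnth j.
set D := sphere_mean _.
pose F (y : n.-tuple R) := tnth y j * f (tnth y i).
have Fb : sphere_bounded F by exact: sphere_boundedM.
have Db : sphere_bounded (fun y => tnth y j ^+ 2 * g (tnth y i) -
    tnth y i * f (tnth y i)).
  apply: sphere_boundedD; first by apply: sphere_boundedM => //; exact: sphere_boundedX.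
  by apply: sphere_boundedN; exact: sphere_boundedM.
pose v (a : R) := [tuple a *+ (k == i) + (k == j)%:R | k < n].
have vy a y : dotprod (v a) y = a * tnth y i + tnth y j by exact: dotprod_axes.
have vi a : tnth (v a) i = a.
  by rewrite tnth_mktuple eqxx eq_sym (negbTE ij) /= mulr1n addr0.
have vj a : tnth (v a) j = 1.
  by rewrite tnth_mktuple eqxx (negbTE ij) /= mulr0n add0r.
have vv a : dotprod (v a) (v a) = 1 + a ^+ 2 by rewrite vy vi vj -expr2 addrC.
have vv0 a : dotprod (v a) (v a) != 0.
  by rewrite vv gt_eqF// ltr_pwDl// sqr_ge0.
pose Q a := reflection (v a).
have QE a := sphere_mean_mxact (reflection_orthogonal (vv0 a)) Fb.
have QF a : sphere_bounded (fun y => F (mxact (Q a) y)).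
  exact: sphere_bounded_mxact (reflection_orthogonal (vv0 a)) Fb.
(* At [a = 0] the reflection changes the sign of [y_j] and fixes [y_i], so the mean of [F] is its
   own opposite. *)
have F0 : sphere_mean F = 0.
  have := QE 0; rewrite (_ : sphere_mean _ = - sphere_mean F); first by lra.
  rewrite -mulN1r -sphere_meanZ//; apply: eq_sphere_mean => y _.
  rewrite /F !mxact_reflection vv !vy vi vj mulr0 subr0.
  by field.
case: (fg) => _ _ [K K0 H].
(* By invariance the mean of [G] is exactly [- 2 a D], while pointwise [G] is the second-order
   remainder of the expansion in [a]. In the final decomposition of [G] the terms with [f x], [g x]
   and [r] contribute 4, 24 + 4 and 16 times [K a^2]. *)
have bound (a : R) : `|a| <= 1 -> `|2 * a * D| <= 48 * K * a ^+ 2.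
  move=> a1.
  pose G y := F (mxact (Q a) y) + F y +
    (- (2 * a)) * (tnth y j ^+ 2 * g (tnth y i) - tnth y i * f (tnth y i)).
  have Gb : sphere_bounded G.
    apply: sphere_boundedD; first exact: sphere_boundedD.
    by apply: sphere_boundedM => //; exact: sphere_bounded_cst.
  have GE : sphere_mean G = - (2 * a * D).
    rewrite sphere_meanD; last 2 first.
    - exact: sphere_boundedD.
    - by apply: sphere_boundedM => //; exact: sphere_bounded_cst.
    by rewrite sphere_meanD// QE F0 sphere_meanZ// !add0r mulNr.
  have GK y : usphere y -> `|G y| <= 48 * K * a ^+ 2.
    move=> sy; have sy' : usphere (mxact (Q a) y).
      by apply/mxact_usphere => //; exact: reflection_orthogonal.
    rewrite /G /F.
    have := usphere_tnth_le1 i sy'; have := usphere_tnth_le1 j sy'.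
    have x1 := usphere_tnth_le1 i sy; have z1 := usphere_tnth_le1 j sy.
    set x' := tnth _ i; set z' := tnth (mxact _ _) j => z'1 x'1.
    set x := tnth y i in x1 *; set z := tnth y j in z1 *.
    have [fK gK rK] := H x x' x1 x'1.
    set r := f x' - f x - g x * (x' - x) in rK *.
    pose k := (1 + a ^+ 2)^-1.
    have k0 : 0 <= k by rewrite invr_ge0 addr_ge0// sqr_ge0.
    have kE : k * (1 + a ^+ 2) = 1.
      by rewrite mulVf// gt_eqF// ltr_pwDl// sqr_ge0.
    have a2 : 0 <= a ^+ 2 by exact: sqr_ge0.
    have k1 : k <= 1 by nra.
    have kb : `|k| <= 1 by rewrite ger0_norm.
    have k'b : `|1 - k| <= 1 by rewrite ger0_norm; lra.
    have hE : x' - x = - 2 * a * (k * (a * x + z)).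
      by rewrite /x' mxact_reflection vv vy vi -/x -/z /k; ring.
    have zE : z' = z - 2 * (k * (a * x + z)).
      by rewrite /z' mxact_reflection vv vy vj -/x -/z /k; ring.
    have na2 : `|a| * `|a| = a ^+ 2 by rewrite -expr2 real_normK ?num_real.
    have na0 := normr_ge0 a.
    have ax : `|a * x| <= `|a| by have := ler_normM2 (lexx `|a|) x1; rewrite mulr1.
    have kax : `|k * (a * x + z)| <= 2.
      have := ler_normM2 kb (le_trans (ler_normD (a * x) z) (lerD (le_trans ax a1) z1)).
      by rewrite mul1r; apply: le_trans; lra.
    have hb : `|x' - x| <= 4 * `|a|.
      rewrite hE; have n2 : `|- 2 * a| <= 2 * `|a|.
        by rewrite normrM normrN (@ger0_norm _ 2) ?lexx.
      by have := ler_normM2 n2 kax; lra.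
    have db : `|z' + z + 2 * a * x| <= 4 * a ^+ 2.
      have -> : z' + z + 2 * a * x = 2 * a ^+ 2 * (k * (z + a * x)).
        rewrite zE; transitivity (2 * ((1 - k) * (z + a * x))); first by ring.
        by rewrite (_ : 1 - k = k * a ^+ 2); [ring|lra].
      rewrite addrC in kax.
      have n2 : `|2 * a ^+ 2| <= 2 * a ^+ 2 by rewrite ger0_norm ?lexx//; nra.
      by have := ler_normM2 n2 kax; lra.
    have eb : `|x' - x + 2 * a * z| <= 4 * a ^+ 2.
      have -> : x' - x + 2 * a * z = - (2 * a ^+ 2 * (k * (x - a * z))).
        rewrite hE; transitivity (- 2 * a * (k * a * x - (1 - k) * z)); first by ring.
        by rewrite (_ : 1 - k = k * a ^+ 2); [ring|lra].
      rewrite normrN.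
      have az : `|a * z| <= 1 by have := ler_normM2 a1 z1; rewrite mulr1.
      have := ler_normM2 kb (le_trans (ler_normB x (a * z)) (lerD x1 az)).
      rewrite mul1r => kaz.
      have n2 : `|2 * a ^+ 2| <= 2 * a ^+ 2 by rewrite ger0_norm ?lexx//; nra.
      by have := ler_normM2 n2 kaz; lra.
    have rb : `|r| <= 16 * K * a ^+ 2.
      apply: le_trans rK _; rewrite [16 * K]mulrC -mulrA ler_wpM2l//.
      rewrite -(real_normK (num_real (x' - x))) expr2.
      apply: le_trans (ler_pM (normr_ge0 _) (normr_ge0 _) hb hb) _.
      by rewrite -na2; lra.
    have zz : `|z' + z| <= 6 * `|a|.
      have -> : z' + z = z' + z + 2 * a * x - 2 * (a * x) by ring.
      apply: le_trans (ler_normB _ _) _.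
      have n2 : `|2 * (a * x)| <= 2 * `|a| by rewrite normrM ger0_norm//; lra.
      apply: le_trans (lerD db n2) _; rewrite -na2; nra.
    have -> : z' * f x' + z * f x + - (2 * a) * (z ^+ 2 * g x - x * f x) =
       f x * (z' + z + 2 * a * x) + g x * ((z' + z) * (x' - x)
         - z * (x' - x + 2 * a * z)) + z' * r.
      by rewrite /r; ring.
    apply: le_trans (ler_normD _ _) _.
    apply: le_trans (lerD (ler_normD _ _) (ler_normM2 z'1 rb)) _.
    have b1 := ler_normM2 fK db.
    have b2 := ler_normM2 gK (le_trans (ler_normB _ _)
      (lerD (ler_normM2 zz hb) (ler_normM2 z1 eb))).
    apply: le_trans (lerD (lerD b1 b2) (lexx _)) _.
    by rewrite (_ : 6 * `|a| * (4 * `|a|) = 24 * a ^+ 2); [lra|rewrite -na2; ring].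
  rewrite -normrN -GE ler_norml; apply/andP; split.
    rewrite -(sphere_mean_cst (- _)); apply: le_sphere_mean => //.
      exact: sphere_bounded_cst.
    by move=> y /GK; rewrite ler_norml => /andP[].
  rewrite -[leRHS]sphere_mean_cst; apply: le_sphere_mean => //.
    exact: sphere_bounded_cst.
  by move=> y /GK; rewrite ler_norml => /andP[].
apply/eqP; rewrite -normr_eq0 eq_le normr_ge0 andbT leNgt; apply/negP => D0.
(* Dividing [bound] by [a] gives [2 |D| <= 48 K a], and this [a] makes the right side smaller than
   [|D|]. *)
pose a := Num.min 1 (`|D| / (48 * K + 1)).
have KK : 0 < 48 * K + 1 by lra.
have a0 : 0 < a by rewrite lt_min ltr01 divr_gt0.
have a1 : a <= 1 by rewrite ge_min lexx.
have aD : a * (48 * K + 1) <= `|D| by rewrite -ler_pdivlMr// ge_min lexx orbT.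
have a1' : `|a| <= 1 by rewrite ger0_norm// ltW.
have := bound a a1'; rewrite !normrM (ger0_norm (ltW a0)) (@ger0_norm _ 2)// => le1.
have : 2 * `|D| <= 48 * K * a.
  by rewrite -(ler_pM2l a0); move: le1; rewrite expr2; lra.
by lra.
Qed.

(* Integration by parts for the density proportional to [(1 - x^2)^((n-3)/2)]
   of one coordinate. *)
Lemma sphere_stein (f g : R -> R) (i : 'I_n) : C11 f g ->
  sphere_mean (fun y => (1 - tnth y i ^+ 2) * g (tnth y i) -
                        (n%:R - 1) * (tnth y i * f (tnth y i))) = 0.
Proof.
move=> fg; have [fb gb] := sphere_bounded_C11 i fg.
(* Sum the reflection identity over the [n - 1] indices [j] other than [i]; on the sphere the
   squares [y_j^2] add up to [1 - y_i^2]. *)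
rewrite (_ : sphere_mean _ = sphere_mean (fun y => \sum_(j < n | j != i)
    (tnth y j ^+ 2 * g (tnth y i) - tnth y i * f (tnth y i)))).
  under eq_fun do rewrite -big_filter.
  rewrite sphere_mean_sum; last first.
    move=> j; apply: sphere_boundedD.
      apply: sphere_boundedM => //; apply: sphere_boundedX.
      exact: sphere_bounded_tnth.
    by apply: sphere_boundedN; apply: sphere_boundedM => //; exact: sphere_bounded_tnth.
  rewrite big_filter; apply: big1 => j ji.
  exact: sphere_mean_reflection.
apply: eq_sphere_mean => y sy.
rewrite sumrB -mulr_suml sumr_const.
have := sum_sqr_usphere sy; rewrite (bigD1 i)//= => s1.
have -> : \sum_(j < n | j != i) tnth y j ^+ 2 = 1 - tnth y i ^+ 2.
  by rewrite -s1 addrAC subrr add0r.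
congr (_ - _).
rewrite -[RHS]mulr_natl; congr (_ * _).
have -> : #|(fun j : 'I_n => j != i)| = n.-1 by rewrite cardC1 card_ord.
have n0 : (0 < n)%N by exact: leq_ltn_trans (ltn_ord i).
by rewrite -{1}(prednK n0) -natr1 addrK.
Qed.

End sphere_expectation.

(** * Spherical caps *)

Section sphere_caps.
Variables (R : realType) (n : nat) (mu : probability (n.-tuple R) R).
Hypothesis mu_uniform : uniform_sphere mu.

(** The reflection along [v = u - e_i] exchanges [u] and [e_i], so it turns the coordinate [y_i]
    into [dotprod u y]. If [v] is null then [u = e_i] and the two sets coincide. *)
Lemma sphere_direction (u : n.-tuple R) (i : 'I_n) (B : set R) :
  usphere u -> measurable B ->
  mu [set y | B (dotprod u y)] = mu [set y | B (tnth y i)].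
Proof.
move=> su mB; pose e : n.-tuple R := [tuple (k == i)%:R | k < n].
have ey y : dotprod e y = tnth y i.
  rewrite /dotprod (bigD1 i)//= big1 ?addr0 ?tnth_mktuple ?eqxx ?mul1r//.
  by move=> k /negbTE ki; rewrite tnth_mktuple ki mul0r.
pose v : n.-tuple R := [tuple tnth u k - 1 * tnth e k | k < n].
have vy y : dotprod v y = dotprod u y - tnth y i.
  by rewrite dotprodBl mul1r ey.
have ei : tnth e i = 1 by rewrite tnth_mktuple eqxx.
have vi : tnth v i = tnth u i - 1 by rewrite tnth_mktuple ei mul1r.
have vv : dotprod v v = 2 - 2 * tnth u i.
  rewrite vy vi dotprodC dotprodBl mul1r ey (_ : dotprod u u = 1); last exact/usphereE.
  by ring.
have [v0|v0] := eqVneq (dotprod v v) 0.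
  congr (mu _); apply/funext => y; apply/propext => /=.
  suff -> : dotprod u y = tnth y i by [].
  have := cauchy_schwarz v y; rewrite v0 mul0r => vy0.
  by apply/eqP; rewrite -subr_eq0 -vy -sqrf_eq0 eq_le vy0 sqr_ge0.
have := mu_uniform.2 _ (reflection_orthogonal v0) [set y | B (tnth y i)].
have mBi : measurable [set y : n.-tuple R | B (tnth y i)].
  by rewrite -[X in measurable X]setTI; exact: measurable_tnth.
move=> <-//; congr (mu _); apply/funext => y; apply/propext => /=.
rewrite mxact_reflection vv vy vi.
rewrite (_ : _ - _ = dotprod u y)//.
by field; rewrite -vv.
Qed.

(** Apply [sphere_stein] to [f(x) = x I(x)^(k+1)] with [I(x) = 1 / (tau - x^2)]. The relations
    [I (1 - x^2) = 1 - (tau - 1) I] and [I x^2 = tau I - 1] express everything in powers of [I], and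
    the terms carrying [tau - 1] have the favourable sign. Taking [tau > 1] keeps [f] regular at -1
    and 1, while the estimate is uniform in [tau]. *)
Lemma sphere_inverse_moment_step (tau : R) (k : nat) (i : 'I_n) : 1 < tau ->
  (2 * k.+1 < n)%N ->
  (n%:R - 2 * k.+1%:R - 1) *
    sphere_mean mu (fun y => ((tau - tnth y i ^+ 2) `^ (-1)) ^+ k.+1) <=
  (n%:R - 2 * k.+1%:R) *
    sphere_mean mu (fun y => ((tau - tnth y i ^+ 2) `^ (-1)) ^+ k).
Proof.
move=> tau1 kn.
pose D (x : R) := tau - x ^+ 2; pose I (x : R) := D x `^ (-1).
have DC : C11 D (fun x => - 2 * x).
  apply: eq_C11 (C11_add (C11_cst tau) (C11_mul (C11_cst (-1)) (C11_exp 2 (@C11_id R)))).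
    by move=> x; rewrite /D mulN1r.
  by move=> x /=; ring.
have De x : `|x| <= 1 -> tau - 1 <= D x.
  move=> x1; rewrite lerD2l lerN2 -(real_normK (num_real x)).
  by rewrite exprn_ile1.
have tau0 : 0 < tau - 1 by rewrite subr_gt0.
have IC := C11_inv tau0 De DC.
have fC := C11_mul (@C11_id R) (C11_exp k.+1 IC).
have Ib j : sphere_bounded (fun y : n.-tuple R => I (tnth y i) ^+ j).
  by have [] := sphere_bounded_C11 i (C11_exp j IC).
have := sphere_stein mu_uniform i fC.
set a : R := n%:R - 2 * k.+1%:R.
have a1 : 1 <= a.
  by rewrite /a lerBrDr -[2 * _]natrM nat1r ler_nat.
move=> s0; rewrite -subr_ge0.
have cb (c : R) j : sphere_bounded (fun y : n.-tuple R => c * I (tnth y i) ^+ j).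
  by apply: sphere_boundedM => //; exact: sphere_bounded_cst.
have -> : a * sphere_mean mu (fun y => I (tnth y i) ^+ k) -
    (a - 1) * sphere_mean mu (fun y => I (tnth y i) ^+ k.+1) =
  sphere_mean mu (fun y => a * I (tnth y i) ^+ k +
    (- (a - 1)) * I (tnth y i) ^+ k.+1).
  by rewrite sphere_meanD// !sphere_meanZ// mulNr.
rewrite -s0; apply: le_sphere_mean.
- have [fb gb] := sphere_bounded_C11 i fC.
  have ib := @sphere_bounded_tnth R n i.
  apply: sphere_boundedD.
    apply: sphere_boundedM => //.
    apply: sphere_boundedD; first exact: sphere_bounded_cst.
    by apply: sphere_boundedN; exact: sphere_boundedX.
  apply: sphere_boundedN; apply: sphere_boundedM; first exact: sphere_bounded_cst.
  exact: sphere_boundedM.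
- exact: sphere_boundedD.
move=> y sy /=; have := usphere_tnth_le1 i sy; set x := tnth y i => x1.
have Dx : 0 < D x by apply: lt_le_trans (De _ x1).
have ID : I x * D x = 1.
  by rewrite /I powR_inv1; [rewrite mulVf// gt_eqF|exact: ltW].
have I0 : 0 <= I x by exact: powR_ge0.
have x21 : x ^+ 2 <= 1 by rewrite -(real_normK (num_real x)) exprn_ile1.
rewrite -/(I x); set J := I x in ID I0 *.
have Jk : 0 <= J ^+ k by rewrite exprn_ge0.
have JD : J * x ^+ 2 = tau * J - 1 by rewrite -ID /D; ring.
rewrite (exprS J k).
rewrite [leLHS](_ : _ = J ^+ k * ((1 - (tau - 1) * J) +
   (J * x ^+ 2) * (2 * k.+1%:R * (1 - (tau - 1) * J) - (n%:R - 1)))); last first.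
  rewrite (_ : 1 - (tau - 1) * J = J * (1 - x ^+ 2)); last by rewrite mulrBr JD; ring.
  by rewrite expr2; ring.
rewrite [leRHS](_ : _ = J ^+ k * (a - (a - 1) * J)); last by ring.
apply: ler_wpM2l => //.
have p1 : 0 <= (tau - 1) * J by rewrite mulr_ge0// ltW.
have p2 : 0 <= J * x ^+ 2 by rewrite mulr_ge0// sqr_ge0.
have p3 : 0 <= J * x ^+ 2 * (2 * k.+1%:R * ((tau - 1) * J)).
  by rewrite mulr_ge0// mulr_ge0// mulr_ge0// ler0n.
have p4 : 0 <= (a - 1) * ((tau - 1) * J) by rewrite mulr_ge0// subr_ge0.
apply: (@le_trans _ _ (1 - (a - 1) * (J * x ^+ 2))).
  by rewrite /a; lra.
by rewrite JD; lra.
Qed.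

(** The weight [n - 2 k - 2] makes the steps telescope: step [k] bounds [(n - 2 k - 3) M (k+1)] by
    [(n - 2 k - 2) M k], and the next weight is [n - 2 k - 4]. At [k = m] the weight is still at
    least 1, so moments of order almost [n / 2] are controlled. *)
Lemma sphere_inverse_moment (tau : R) (m : nat) (i : 'I_n) : 1 < tau ->
  (2 * m + 3 <= n)%N ->
  sphere_mean mu (fun y => ((tau - tnth y i ^+ 2) `^ (-1)) ^+ m) <= n%:R.
Proof.
move=> tau1 mn.
pose M k := sphere_mean mu (fun y => ((tau - tnth y i ^+ 2) `^ (-1)) ^+ k).
have M0 k : 0 <= M k.
  by apply: Rintegral_ge0 => y _; rewrite exprn_ge0// powR_ge0.
have H k : (k <= m)%N -> (n%:R - 2 * k%:R - 2) * M k <= n%:R.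
  elim: k => [|k IH] km.
    rewrite /M; under eq_fun do rewrite expr0.
    by rewrite sphere_mean_cst// mulr1 mulr0 subr0 lerBlDr lerDl.
  apply: le_trans (IH (ltnW km)).
  have kn : (2 * k.+1 < n)%N by lia.
  have := sphere_inverse_moment_step i tau1 kn; rewrite -/(M k) -/(M k.+1).
  have := M0 k.+1; rewrite -natr1; lra.
have := H m (leqnn m); rewrite -/(M m); apply: le_trans.
rewrite -{1}[M m]mul1r; apply: ler_wpM2r => //.
have : (2 * m + 3)%:R <= n%:R :> R by rewrite ler_nat.
by rewrite natrD natrM; lra.
Qed.

(** Markov's inequality for the inverse moment with [tau = s + r^2]: on the cap [tau - y_i^2 <= s],
    hence [s^m I^m >= 1] there. The strict inequality [1 - r^2 < s] is what gives [tau > 1]. *)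
Lemma sphere_cap_le (u : n.-tuple R) (r s : R) (m : nat) :
  usphere u -> 0 < s -> 0 <= r -> 1 - r ^+ 2 < s -> (2 * m + 3 <= n)%N ->
  (mu [set y | (r <= dotprod u y)%R] <= (n%:R * s ^+ m)%:E)%E.
Proof.
move=> su s0 r0 rs mn.
have n0 : (0 < n)%N by lia.
pose i := Ordinal n0.
have mr : measurable [set x : R | r <= x].
  by rewrite -[X in measurable X]set_itvcy; exact: measurable_itv.
rewrite (sphere_direction i su mr).
have mA : measurable [set y : n.-tuple R | r <= tnth y i].
  rewrite -[X in measurable X]setTI.
  exact: (@measurable_tnth _ _ n i measurableT _ mr).
rewrite -(sphere_mean_indic mu_uniform mA) lee_fin.
pose tau := s + r ^+ 2.
have tau1 : 1 < tau by rewrite /tau; lra.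
have := sphere_inverse_moment i tau1 mn.
pose D (x : R) := tau - x ^+ 2; pose I (x : R) := D x `^ (-1).
have mI : measurable_fun [set: n.-tuple R] (fun y => I (tnth y i) ^+ m).
  apply: measurable_funX; apply: (measurableT_comp (measurable_powR (-1))).
  apply: measurable_funB => //; apply: measurable_funX; exact: measurable_tnth.
have De x : `|x| <= 1 -> tau - 1 <= D x.
  move=> x1; rewrite lerD2l lerN2 -(real_normK (num_real x)).
  by rewrite exprn_ile1.
have tau0 : 0 < tau - 1 by rewrite subr_gt0.
have Ib : sphere_bounded (fun y : n.-tuple R => I (tnth y i) ^+ m).
  split => //; exists ((tau - 1)^-1 ^+ m) => y sy.
  have Dy := De _ (usphere_tnth_le1 i sy).
  rewrite /I powR_inv1; last by rewrite (le_trans (ltW tau0)).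
  rewrite ger0_norm ?exprn_ge0 ?invr_ge0 ?(le_trans (ltW tau0))//.
  rewrite lerXn2r ?nnegrE ?invr_ge0 ?(le_trans (ltW tau0))//.
  by rewrite lef_pV2 ?posrE// (lt_le_trans tau0).
move=> Mn; rewrite mulrC.
apply: (@le_trans _ _ (s ^+ m * sphere_mean mu (fun y => I (tnth y i) ^+ m))).
  rewrite -sphere_meanZ//; apply: le_sphere_mean => //.
  - exact: sphere_bounded_indic.
  - by apply: sphere_boundedM => //; exact: sphere_bounded_cst.
  move=> y sy; rewrite indicE.
  have Dy : 0 < D (tnth y i) by exact: lt_le_trans (De _ (usphere_tnth_le1 i sy)).
  have I0 : 0 <= I (tnth y i) by exact: powR_ge0.
  case: (boolP (y \in _)) => yA; last by rewrite mulr_ge0// exprn_ge0// ltW.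
  have ry : r <= tnth y i by move: yA; rewrite inE.
  rewrite -exprMn exprn_ege1//.
  have -> : I (tnth y i) = (D (tnth y i))^-1 by rewrite /I powR_inv1// ltW.
  rewrite ler_pdivlMr// mul1r /D /tau.
  have : r ^+ 2 <= tnth y i ^+ 2 by rewrite ler_sqr ?nnegrE// (le_trans r0).
  by lra.
by rewrite ler_wpM2l// exprn_ge0// ltW.
Qed.

(** A function of mean zero that is at most [- b / 4] where [|y_i| < t] must be positive elsewhere;
    as it is at most [n / W] everywhere, the set [|y_i| >= t] cannot be too small. The function is
    produced by [sphere_stein]. *)
Lemma sphere_cap_ge (u : n.-tuple R) (t : R) (j : nat) :
  usphere u -> 0 < t -> t < 1 -> (0 < n)%N -> (n <= (2 * j).+1)%N ->
  (((1 - t ^+ 2) ^+ j.+2 / (32 * n%:R ^+ 2))%:E <=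
    mu [set y | (t <= dotprod u y)%R])%E.
Proof.
move=> su t0 t1 n0 nj; pose i := Ordinal n0.
have mt : measurable [set x : R | t <= x].
  by rewrite -[X in measurable X]set_itvcy; exact: measurable_itv.
have mt' : measurable [set x : R | x <= - t].
  by rewrite -[X in measurable X]set_itvNyc; exact: measurable_itv.
have mpre (B : set R) : measurable B ->
    measurable [set y : n.-tuple R | B (tnth y i)].
  by move=> mB; rewrite -[X in measurable X]setTI; exact: measurable_tnth.
(* The test function below is odd, so it sees both opposite caps; they have the same mass, which
   costs the last factor 2 in the 32. *)
pose A : set (n.-tuple R) := [set y | t <= `|tnth y i|].
have AE : A = [set y | t <= tnth y i] `|` [set y | tnth y i <= - t].
  apply/funext => y; apply/propext; rewrite /A /= ler_normr; split.
    by case/orP => ?; [left|right; rewrite lerNr].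
  by case=> h; apply/orP; [left|right; rewrite lerNr].
have mA : measurable A.
  by rewrite AE; apply: measurableU; [exact: mpre mt|exact: mpre mt'].
have A2 : (mu A <= 2%:E * mu [set y | (t <= dotprod u y)%R])%E.
  rewrite AE; apply: le_trans (measureU2 _ (mpre _ mt) (mpre _ mt')) _.
  rewrite -[2]/(1 + 1) EFinD ge0_muleDl// !mul1e.
  apply: leeD; first by rewrite (sphere_direction i su mt).
  pose w : n.-tuple R := [tuple - tnth u k | k < n].
  have wu y : dotprod w y = - dotprod u y.
    rewrite /dotprod -sumrN; apply: eq_bigr => k _.
    by rewrite tnth_mktuple mulNr.
  have sw : usphere w by rewrite usphereE wu dotprodC wu opprK; apply/usphereE.
  have /= <- := sphere_direction i sw mt'.
  rewrite (_ : [set y | _] = [set y | t <= dotprod u y])//.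
  by apply/funext => y; apply/propext; rewrite /= wu lerN2.
pose p := sphere_mean mu \1_A.
have pA : (p%:E = mu A)%E by exact: sphere_mean_indic.
have t2 : 0 < 1 - t ^+ 2 by rewrite subr_gt0 expr_lt1// ltW.
have t21 : 1 - t ^+ 2 <= 1 by rewrite gerBl sqr_ge0.
set b := 1 - t ^+ 2 in t2 t21 *.
have n1 : 1 <= n%:R :> R by rewrite ler1n.
(* The regularisation [W] is small enough that [n W] is half of [b^(j+1)], which bounds
   [(1 - x^2) w(x)] from below when [|x| < t]. *)
pose W := b ^+ j.+1 / (2 * n%:R).
have bj : b ^+ j.+1 <= 1 by rewrite exprn_ile1// ltW.
have W0 : 0 < W by rewrite divr_gt0 ?exprn_gt0//; lra.
have Wn : n%:R * W = b ^+ j.+1 / 2 by rewrite /W; field; lra.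
have W1 : W <= 1 by nra.
suff H : b / 4 <= (n%:R / W + 1) * p.
  have p8 : b * W / (8 * n%:R) <= p.
    rewrite ler_pdivrMr; last by lra.
    have p0 : 0 <= p by apply: Rintegral_ge0.
    have : b * W <= 4 * (n%:R + W) * p.
      have := ler_wpM2l (ltW W0) H.
      rewrite (_ : W * (_ * p) = (n%:R + W) * p); last by field; lra.
      by lra.
    by nra.
  have : ((b * W / (8 * n%:R))%:E <= 2%:E * mu [set y | (t <= dotprod u y)%R])%E.
    by apply: le_trans A2; rewrite -pA lee_fin.
  rewrite -lee_pdivrMl// -EFinM; congr (_ <= _)%E; congr EFin.
  by rewrite /W [in RHS]exprS; field; lra.
(* The test function is [f(x) = - x / (w(x) + W)]. In [(1 - x^2) f' - (n - 1) x f] the derivative of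
   [w] yields [- 2 j x^2 w I^2], which absorbs [(n - 1) x^2 w I^2] because [n - 1 <= 2 j]. What
   remains is [I^2] times [- (1 - x^2) S + (n - 1) x^2 W]. *)
pose w (x : R) := (1 - x ^+ 2) ^+ j.
pose S x := w x + W; pose I x := S x `^ (-1).
have DC : C11 (fun x : R => 1 - x ^+ 2) (fun x => - 2 * x).
  apply: eq_C11 (C11_add (C11_cst 1) (C11_mul (C11_cst (-1)) (C11_exp 2 (@C11_id R)))).
    by move=> x; rewrite mulN1r.
  by move=> x /=; ring.
have SC := C11_add (C11_exp j DC) (C11_cst W).
have x21 (x : R) : `|x| <= 1 -> 0 <= 1 - x ^+ 2 <= 1.
  move=> x1; rewrite gerBl sqr_ge0 andbT subr_ge0.
  by rewrite -(real_normK (num_real x)) exprn_ile1.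
have Se x : `|x| <= 1 -> W <= S x.
  by move=> /x21/andP[x0 _]; rewrite lerDr exprn_ge0.
have IC := C11_inv W0 Se SC.
have fC := C11_mul (C11_mul (C11_cst (-1)) (@C11_id R)) IC.
have s0 := sphere_stein mu_uniform i fC.
have [fb gb] := sphere_bounded_C11 i fC.
have ib := @sphere_bounded_tnth R n i.
have Lb : sphere_bounded (fun y : n.-tuple R => (1 - tnth y i ^+ 2) *
   ((0 * tnth y i + -1 * 1) * I (tnth y i) + (-1 * tnth y i) *
    (- (j%:R * (1 - tnth y i ^+ 2) ^+ j.-1 * (- 2 * tnth y i) + 0) * I (tnth y i) ^+ 2))
   - (n%:R - 1) * (tnth y i * ((-1 * tnth y i) * I (tnth y i)))).
  apply: sphere_boundedD.
    apply: sphere_boundedM => //.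
    apply: sphere_boundedD; first exact: sphere_bounded_cst.
    by apply: sphere_boundedN; exact: sphere_boundedX.
  apply: sphere_boundedN; apply: sphere_boundedM; first exact: sphere_bounded_cst.
  exact: sphere_boundedM.
have Ab := sphere_bounded_indic mA.
rewrite -sphere_meanZ// -[leLHS]addr0 -[X in _ + X <= _]s0.
rewrite -[X in X + _](sphere_mean_cst mu_uniform) -sphere_meanD//; last exact: sphere_bounded_cst.
apply: le_sphere_mean => //.
- by apply: sphere_boundedD => //; exact: sphere_bounded_cst.
- by apply: sphere_boundedM => //; exact: sphere_bounded_cst.
move=> y sy; rewrite indicE -/(S _) -/(I _).
have := usphere_tnth_le1 i sy; set x := tnth y i => x1.
have /andP[y0 y1] := x21 _ x1.
have Sx : 0 < S x by exact: lt_le_trans (Se _ x1).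
have IS : I x * S x = 1.
  by rewrite /I powR_inv1; [rewrite mulVf// gt_eqF|exact: ltW].
have I0 : 0 <= I x by exact: powR_ge0.
have w0 : 0 <= w x by rewrite exprn_ge0.
have w1 : w x <= 1 by rewrite exprn_ile1.
have jw : (1 - x ^+ 2) * (j%:R * (1 - x ^+ 2) ^+ j.-1) = j%:R * w x.
  rewrite /w; case: (j) => [|k]; first by rewrite !mul0r mulr0.
  by rewrite (exprS _ k) /= mulrCA.
have nj' : n%:R - 1 <= 2 * j%:R :> R.
  by rewrite lerBlDr -natrM natr1 ler_nat.
have x20 := sqr_ge0 x.
rewrite [X in _ + X](_ : _ = I x ^+ 2 * (- (1 - x ^+ 2) * S x - 2 * j%:R * x ^+ 2 * w x
    + (n%:R - 1) * x ^+ 2 * S x)); last first.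
  transitivity (- (1 - x ^+ 2) * I x * (I x * S x) - 2 * I x ^+ 2 * x ^+ 2 *
    ((1 - x ^+ 2) * (j%:R * (1 - x ^+ 2) ^+ j.-1)) + (n%:R - 1) * x ^+ 2 * I x * (I x * S x)).
    by rewrite IS; ring.
  rewrite jw; move: (S x) (w x) (I x) => a1 a2 a3; ring.
have I2 : 0 <= I x ^+ 2 by exact: sqr_ge0.
have L1 : - (1 - x ^+ 2) * S x - 2 * j%:R * x ^+ 2 * w x + (n%:R - 1) * x ^+ 2 * S x
   <= - (1 - x ^+ 2) * S x + (n%:R - 1) * x ^+ 2 * W.
  rewrite {2}/S; have : 0 <= (2 * j%:R - (n%:R - 1)) * (x ^+ 2 * w x).
    by rewrite mulr_ge0 ?subr_ge0// mulr_ge0.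
  by lra.
apply: le_trans (lerD (lexx _) (ler_wpM2l I2 L1)) _.
have [yA|yA] := boolP (y \in A); rewrite ?mulr1 ?mulr0.
  rewrite addrC; apply: lerD; last by lra.
  have IW : I x * W <= 1 by rewrite -IS ler_wpM2l// /S lerDr.
  rewrite ler_pdivlMr//.
  have : I x ^+ 2 * W ^+ 2 <= 1 by rewrite -exprMn exprn_ile1// mulr_ge0// ltW.
  have a1 : - (1 - x ^+ 2) * S x + (n%:R - 1) * x ^+ 2 * W <= n%:R * W.
    have : 0 <= (1 - x ^+ 2) * S x by rewrite mulr_ge0// ltW.
    have : (n%:R - 1) * x ^+ 2 <= n%:R by nra.
    by move=> /(ler_wpM2r (ltW W0)); lra.
  move=> IW2; apply: le_trans (ler_wpM2r (ltW W0) (ler_wpM2l I2 a1)) _.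
  rewrite [leLHS](_ : _ = n%:R * (I x ^+ 2 * W ^+ 2)); last by ring.
  by rewrite -[leRHS]mulr1 ler_wpM2l.
have xt : x ^+ 2 < t ^+ 2.
  have : `|x| < t.
    by rewrite ltNge; apply: contra yA => ?; rewrite inE.
  by rewrite -(real_normK (num_real x)) ltr_sqr ?nnegrE// ltW.
have bx : b <= 1 - x ^+ 2 by rewrite /b; lra.
have wb : b ^+ j <= w x by rewrite /w lerXn2r ?nnegrE// ltW.
have b1 : (n%:R - 1) * x ^+ 2 * W <= (1 - x ^+ 2) * S x / 2.
  have : (n%:R - 1) * x ^+ 2 * W <= n%:R * W.
    by apply: ler_wpM2r; [exact: ltW|nra].
  rewrite Wn => /le_trans; apply.
  rewrite exprS ler_wpM2r// ?invr_ge0//.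
  by apply: ler_pM => //; [exact: ltW|rewrite exprn_ge0// ltW|rewrite /S; lra].
have a2 : - (1 - x ^+ 2) * S x + (n%:R - 1) * x ^+ 2 * W <= - (1 - x ^+ 2) * S x / 2.
  by lra.
apply: le_trans (lerD (lexx _) (ler_wpM2l I2 a2)) _.
rewrite (_ : I x ^+ 2 * _ = - (1 - x ^+ 2) / 2 * I x * (I x * S x)); last by ring.
rewrite IS mulr1.
have S2 : S x <= 2 by rewrite /S; lra.
have Ih : 1 / 2 <= I x by nra.
by nra.
Qed.

End sphere_caps.

(** * Moments of the normal distribution *)

Section gaussian_moments.
Variable R : realType.

(** The change of variables holds for the Radon-Nikodym derivative of the normal law, which agrees
    almost everywhere with its density, both having the same integral over every measurable set. *)
Lemma ge0_integral_normal_prob (m s : R) (f : R -> \bar R) :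
  measurable_fun setT f -> (forall x, 0 <= f x)%E ->
  (\int[normal_prob m s]_x f x =
   \int[lebesgue_measure]_x (f x * (normal_pdf m s x)%:E))%E.
Proof.
move=> mf f0; have dom := @normal_prob_dominates R m s.
rewrite -(Radon_Nikodym_SigmaFinite.change_of_variables dom f0 measurableT mf).
have intf := Radon_Nikodym_SigmaFinite.f_integrable dom.
have mpdf : measurable_fun setT (EFin \o normal_pdf m s).
  by apply/measurable_EFinP; exact: measurable_normal_pdf.
apply: ae_eq_integral => //.
- by apply: emeasurable_funM => //; exact: measurable_int intf.
- exact: emeasurable_funM.
- apply: ae_eqe_mul2l; apply: integral_ae_eq => // E _ mE.
  by rewrite -Radon_Nikodym_SigmaFinite.f_integral.
Qed.

(** Tilting: if the factor [r] turns one normal density into [k] times another, its mean is [k],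
    because the new density has mass 1. No other Gaussian integral is ever evaluated. *)
Lemma integral_normal_prob_density (m s m' s' k : R) (r : R -> R) :
  measurable_fun setT r -> (forall x, 0 <= r x) -> 0 <= k ->
  (forall x, r x * normal_pdf m s x = k * normal_pdf m' s' x) ->
  (\int[normal_prob m s]_x (r x)%:E = k%:E)%E.
Proof.
move=> mr r0 k0 rk; rewrite ge0_integral_normal_prob//; last first.
  exact/measurable_EFinP.
under eq_integral do rewrite -EFinM rk EFinM.
rewrite ge0_integralZl//.
- by rewrite integral_normal_pdf mule1.
- by apply/measurable_EFinP; exact: measurable_normal_pdf.
- by move=> x _; rewrite lee_fin normal_pdf_ge0.
Qed.

Lemma normal_exp_linear (m s t : R) : s != 0 ->
  (\int[normal_prob m s]_x (expR (t * (x - m)))%:E =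
   (expR (t ^+ 2 * s ^+ 2 / 2))%:E)%E.
Proof.
move=> s0; apply: (@integral_normal_prob_density _ _ (m + t * s ^+ 2) s).
- apply: measurableT_comp => //; apply: measurable_funM => //.
  exact: measurable_funB.
- by move=> x; exact: expR_ge0.
- exact: expR_ge0.
move=> x; rewrite !normal_pdfE// /normal_fun mulrCA [RHS]mulrCA -!expRD.
by congr (_ * expR _); rewrite -mulr_natr; field.
Qed.

(** The exponent is parametrised by the factor [u] applied to the standard deviation; [u > 1] and
    [u < 1] give exponents of opposite signs, and both are used for the second moment. *)
Lemma normal_exp_square (m s u : R) : 0 < s -> 0 < u ->
  (\int[normal_prob m s]_x
     (expR ((1 - u ^- 2) / (2 * s ^+ 2) * (x - m) ^+ 2))%:E = u%:E)%E.
Proof.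
move=> s0 u0; apply: (@integral_normal_prob_density _ _ m (u * s)).
- apply: measurableT_comp => //; apply: measurable_funM => //.
  by apply: measurable_funX; exact: measurable_funB.
- by move=> x; exact: expR_ge0.
- exact: ltW.
move=> x; have us0 : u * s != 0 by rewrite mulf_neq0 ?gt_eqF.
rewrite !normal_pdfE ?gt_eqF// ?mulr_gt0// /normal_fun /normal_peak.
rewrite [LHS]mulrCA -expRD [RHS]mulrA; congr (_ * expR _).
  rewrite (_ : (u * s) ^+ 2 * pi *+ 2 = u ^+ 2 * (s ^+ 2 * pi *+ 2)).
    rewrite sqrtrM ?sqr_ge0// sqrtr_sqr gtr0_norm//.
    by rewrite invfM mulrA divff ?mul1r// gt_eqF.
  by rewrite exprMn -mulrA -mulrnAr.
rewrite -[s ^+ 2 *+ 2]mulr_natl -[(u * s) ^+ 2 *+ 2]mulr_natl.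
by field; rewrite !gt_eqF.
Qed.

Lemma sqr_le_expR (y : R) : 0 <= y -> y ^+ 2 <= 2 * expR y.
Proof.
move=> y0; have := @expR_ge1Dxn R y 1 y0.
by rewrite -ler_pdivrMl// mulrC; apply: le_trans; rewrite lerDr.
Qed.

Lemma normal_fourth_moment (m s : R) : 0 < s ->
  (\int[normal_prob m s]_x ((x - m) ^+ 4)%:E <= (32 * s ^+ 4)%:E)%E.
Proof.
move=> s0; have s0' : s != 0 by rewrite gt_eqF.
(* The exponent of [normal_exp_square] at [u = 2], namely [3 / (8 s^2)]. From [y^2 <= 2 exp y] at
   [y = k (x - m)^2] the fourth moment is at most [4 / k^2 = 256 / 9 s^4]. *)
pose k : R := (1 - 2 ^- 2) / (2 * s ^+ 2).
have k0 : 0 < k by rewrite /k divr_gt0//; [lra|rewrite mulr_gt0// exprn_gt0].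
have mz : measurable_fun setT (fun x : R => x - m) by exact: measurable_funB.
apply: (@le_trans _ _ (\int[normal_prob m s]_x
    ((2 / k ^+ 2)%:E * (expR (k * (x - m) ^+ 2))%:E))%E).
  apply: ge0_le_integral => //.
  - by move=> x _; rewrite lee_fin exprn_even_ge0.
  - by apply/measurable_EFinP; exact: measurable_funX.
  - apply/measurable_EFinP; apply: measurable_funM => //.
    apply: measurableT_comp => //; apply: measurable_funM => //.
    exact: measurable_funX.
  - move=> x _; rewrite -EFinM lee_fin.
    have y0 : 0 <= k * (x - m) ^+ 2 by rewrite mulr_ge0 ?sqr_ge0// ltW.
    have := sqr_le_expR y0; set e := expR _ => h.
    rewrite [leRHS]mulrAC ler_pdivlMr ?exprn_gt0//.
    by apply: le_trans h; rewrite le_eqVlt; apply/orP; left; apply/eqP; ring.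
rewrite ge0_integralZl//.
- rewrite normal_exp_square// -EFinM lee_fin /k.
  rewrite [leLHS](_ : _ = 256 / 9 * s ^+ 4); last by field.
  by rewrite ler_wpM2r ?exprn_ge0 ?(ltW s0)//; lra.
- apply/measurable_EFinP.
  apply: measurableT_comp => //; apply: measurable_funM => //.
  exact: measurable_funX.
- by rewrite lee_fin divr_ge0 ?sqr_ge0.
Qed.

Lemma normal_integrable_le4 (m s : R) (f : R -> R) (C : R) : 0 < s ->
  measurable_fun setT f -> (forall x, `|f x| <= C * (1 + (x - m) ^+ 4)) ->
  (normal_prob m s).-integrable setT (EFin \o f).
Proof.
move=> s0 mf fC.
have i4 : (normal_prob m s).-integrable setT
    (EFin \o (fun x => (x - m) ^+ 4)).
  apply/integrableP; split.
    by apply/measurable_EFinP; apply: measurable_funX; exact: measurable_funB.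
  apply: (@le_lt_trans _ _ (32 * s ^+ 4)%:E); last exact: ltry.
  apply: le_trans (normal_fourth_moment m s0).
  rewrite le_eqVlt; apply/orP; left; apply/eqP; apply: eq_integral => x _ /=.
  by rewrite ger0_norm// exprn_even_ge0.
have ib : (normal_prob m s).-integrable setT
    (EFin \o (fun x => C * (1 + (x - m) ^+ 4))).
  have := integrableZl measurableT C (integrableD measurableT
     (finite_measure_integrable_cst (normal_prob m s) 1 measurableT) i4).
  by apply: eq_integrable => // x _ /=; rewrite -EFinD -EFinM.
apply: (le_integrable measurableT _ _ ib); first exact/measurable_EFinP.
move=> x _ /=; rewrite lee_fin; apply: le_trans (fC x) _.
by rewrite ler_norm.
Qed.

Lemma le_of_le_small (x y C : R) :
  (forall e, 0 < e -> e <= 1 -> x <= y + C * e) -> x <= y.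
Proof.
move=> H; rewrite leNgt; apply/negP => yx.
pose e := Num.min 1 ((x - y) / (2 * (`|C| + 1))).
have C0 : 0 < `|C| + 1 by rewrite ltr_wpDl.
have e0 : 0 < e by rewrite lt_min ltr01 divr_gt0 ?subr_gt0// mulr_gt0.
have e1 : e <= 1 by rewrite ge_min lexx.
have eC : e * (2 * (`|C| + 1)) <= x - y.
  by rewrite -ler_pdivlMr ?mulr_gt0// ge_min lexx orbT.
have := H e e0 e1; have := ler_wpM2r (ltW e0) (ler_norm C); nra.
Qed.

Section moments.
Variables (m s : R).
Hypothesis s_gt0 : 0 < s.
Local Notation N := (normal_prob m s).

Lemma normal_integrable_pow k : (k <= 4)%N ->
  N.-integrable setT (EFin \o (fun x => (x - m) ^+ k)).
Proof.
move=> k4; apply: (@normal_integrable_le4 _ _ _ 1) => //.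
  by apply: measurable_funX; exact: measurable_funB.
move=> x; rewrite mul1r normrX.
have -> : (x - m) ^+ 4 = `|x - m| ^+ 4.
  by rewrite -normrX ger0_norm// exprn_even_ge0.
set a := `|x - m|; have a0 : 0 <= a by exact: normr_ge0.
have [a1|a1] := leP a 1.
  by apply: (@le_trans _ _ 1); [exact: exprn_ile1|rewrite lerDl exprn_ge0].
by rewrite (le_trans (ler_weXn2l (ltW a1) k4))// lerDr.
Qed.

(** Replaces differentiation of an exponential moment under the integral: with [r] an exponential
    above its tangent [1 + c f], small tilts of both signs squeeze the mean of [f]. *)
Lemma normal_mean_lin_le (r : R -> R) (c v : R) :
  measurable_fun setT r -> (forall x, 0 <= r x) ->
  (\int[N]_x (r x)%:E = v%:E)%E ->
  forall f : R -> R, N.-integrable setT (EFin \o f) ->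
  (forall x, 1 + c * f x <= r x) -> 1 + c * \int[N]_x f x <= v.
Proof.
move=> mr r0 rv f intf fr.
have i1 : N.-integrable setT (EFin \o cst (1 : R)).
  exact: finite_measure_integrable_cst.
have icf : N.-integrable setT (EFin \o (fun x => c * f x)).
  by have := integrableZl measurableT c intf; apply: eq_integrable.
have ir : N.-integrable setT (EFin \o r).
  apply/integrableP; split; first exact/measurable_EFinP.
  rewrite (_ : (\int[_]_x _)%E = v%:E); first exact: ltry.
  by rewrite -rv; apply: eq_integral => x _ /=; rewrite ger0_norm.
have -> : v = \int[N]_x r x by rewrite /Rintegral rv.
have {1}-> : 1 = \int[N]_x (cst (1 : R) x).
  by rewrite Rintegral_cst// mul1r [X in fine X]probability_setT.
rewrite -RintegralZl// -RintegralD//; apply: le_Rintegral => //.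
have := integrableD measurableT i1 icf.
by apply: eq_integrable.
Qed.

Lemma normal_mean0 : \int[N]_x (x - m) = 0.
Proof.
have i1 : N.-integrable setT (EFin \o (fun x => x - m)).
  exact: (@normal_integrable_pow 1).
have H t : 1 + t * \int[N]_x (x - m) <= expR (t ^+ 2 * s ^+ 2 / 2).
  have s0 : s != 0 by rewrite gt_eqF.
  apply: (normal_mean_lin_le _ _ (normal_exp_linear m t s0) i1).
  - apply: measurableT_comp => //; apply: measurable_funM => //.
    exact: measurable_funB.
  - by move=> x; exact: expR_ge0.
  - by move=> x; exact: expR_ge1Dx.
set v := \int[N]_x _ in H *.
have s2 : 0 < s ^+ 2 by rewrite exprn_gt0.
(* The tilts [t = e / s] and [t = - e / s] give [t v <= e^2], since [exp (e^2 / 2) <= 1 + e^2] for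
   [e <= 1]. *)
have B (e : R) : 0 < e -> e <= 1 -> `|v| <= 0 + s * e.
  move=> e0 e1.
  have E t : t ^+ 2 * s ^+ 2 = e ^+ 2 -> t * v <= e ^+ 2.
    move=> te; have := H t; rewrite te.
    have := expR_ge1Dx (- (e ^+ 2 / 2)); rewrite expRN.
    set x := expR _ => h1 h2.
    have x0 : 0 < x by exact: expR_gt0.
    have h3 : (1 - e ^+ 2 / 2) * x <= 1.
      by have := ler_wpM2r (ltW x0) h1; rewrite mulVf ?gt_eqF.
    have e2 : e ^+ 2 <= 1 by rewrite exprn_ile1// ltW.
    have e20 := sqr_ge0 e.
    by nra.
  have te (t : R) : t = e / s \/ t = - (e / s) -> t ^+ 2 * s ^+ 2 = e ^+ 2.
    by case=> ->; field; rewrite gt_eqF.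
  have := E _ (te _ (or_introl erefl)); have := E _ (te _ (or_intror erefl)).
  rewrite mulNr -mulNr => h1 h2.
  have es : e / s * s = e by rewrite divfK ?gt_eqF.
  have es0 : 0 < e / s by rewrite divr_gt0.
  rewrite add0r ler_norml; apply/andP; split.
    by rewrite -(ler_pM2l es0); nra.
  by rewrite -(ler_pM2l es0); nra.
by apply/eqP; rewrite -normr_eq0 eq_le normr_ge0 andbT; exact: le_of_le_small B.
Qed.

Lemma normal_second_moment : \int[N]_x (x - m) ^+ 2 = s ^+ 2.
Proof.
have i2 := @normal_integrable_pow 2 isT.
have H u : 0 < u ->
    1 + (1 - u ^- 2) / (2 * s ^+ 2) * \int[N]_x (x - m) ^+ 2 <= u.
  move=> u0; apply: (normal_mean_lin_le _ _ (normal_exp_square m s_gt0 u0) i2).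
  - apply: measurableT_comp => //; apply: measurable_funM => //.
    by apply: measurable_funX; exact: measurable_funB.
  - by move=> x; exact: expR_ge0.
  - by move=> x; exact: expR_ge1Dx.
set v := \int[N]_x _ in H *.
have s2 : 0 < s ^+ 2 by rewrite exprn_gt0.
have v0 : 0 <= v by apply: Rintegral_ge0 => x _; exact: sqr_ge0.
(* The tilt inequality after clearing denominators, with [u - 1] factored out. Dividing by it at
   [u = 1 + e] and at [u = 1 - e] bounds [v] from above and from below by quantities that tend to
   [s^2]. *)
have H' u : 0 < u -> (u - 1) * ((u + 1) * v - 2 * s ^+ 2 * u ^+ 2) <= 0.
  move=> u0; have u2 : 0 < 2 * s ^+ 2 * u ^+ 2 by rewrite !mulr_gt0// exprn_gt0.
  have := H u u0; rewrite -lerBrDl -(ler_pM2r u2).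
  rewrite (_ : _ * v * _ = (u - 1) * ((u + 1) * v)); first lra.
  by field; rewrite !gt_eqF.
apply/eqP; rewrite eq_le; apply/andP; split.
  apply: (@le_of_le_small _ _ (3 * s ^+ 2)) => e e0 e1.
  have u0 : 0 < 1 + e by lra.
  by have := H' _ u0; rewrite [1 + e - 1]addrAC subrr add0r pmulr_rle0//; nra.
apply: (@le_of_le_small _ _ (2 * s ^+ 2)) => e e0 e1.
have [e1'|e1'] := leP (1 / 2) e; first by nra.
have u0 : 0 < 1 - e by lra.
have := H' _ u0.
rewrite addrAC subrr add0r mulNr oppr_le0 pmulr_rge0//; nra.
Qed.

End moments.
End gaussian_moments.

(** * Pairwise independence and Chebyshev's inequality *)

Section joint_law.
Context (R : realType) (d d1 d2 : measure_display) (T : measurableType d)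
  (T1 : measurableType d1) (T2 : measurableType d2) (P : probability T R)
  (m1 : probability T1 R) (m2 : probability T2 R).
Variables (Y1 : T -> T1) (Y2 : T -> T2).
Hypotheses (mY1 : measurable_fun setT Y1) (mY2 : measurable_fun setT Y2).
Hypothesis Y12 : forall A B, measurable A -> measurable B ->
  P (Y1 @^-1` A `&` Y2 @^-1` B) = (m1 A * m2 B)%E.

Let Y w := (Y1 w, Y2 w).
Let mY : measurable_fun setT Y. Proof. exact: measurable_fun_pair. Qed.

Lemma joint_lawE (A : set (T1 * T2)) : measurable A ->
  P (Y @^-1` A) = (m1 \x m2)%E A.
Proof.
by move=> mA; apply/esym/(product_measure_unique
  (m' := measure_function_pushforward__canonical__measure_function_Measure P mY)).
Qed.

Lemma ge0_integral_joint_law (f : T1 * T2 -> \bar R) :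
  measurable_fun setT f -> (forall x, 0 <= f x)%E ->
  (\int[P]_w f (Y w) = \int[m1]_x \int[m2]_y f (x, y))%E.
Proof.
move=> mf f0; rewrite -[LHS]/(\int[P]_(w in Y @^-1` setT) (f \o Y) w)%E.
rewrite -(ge0_integral_pushforward mY P (D := setT))//.
rewrite (eq_measure_integral (m1 \x m2)%E); last first.
  by move=> A mA _; exact: joint_lawE.
by rewrite fubini_tonelli1.
Qed.

Lemma integral_joint_lawM0 (h1 : T1 -> R) (h2 : T2 -> R) :
  m1.-integrable setT (EFin \o h1) -> m2.-integrable setT (EFin \o h2) ->
  \int[m1]_x h1 x = 0 ->
  P.-integrable setT (EFin \o (fun w => h1 (Y1 w) * h2 (Y2 w))) /\
  (\int[P]_w (h1 (Y1 w) * h2 (Y2 w))%:E = 0)%E.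
Proof.
move=> i1 i2 h10.
have mh1 : measurable_fun setT h1 by exact/measurable_EFinP/(measurable_int m1).
have mh2 : measurable_fun setT h2 by exact/measurable_EFinP/(measurable_int m2).
pose f (z : T1 * T2) := h1 z.1 * h2 z.2.
have mf : measurable_fun setT f.
  by apply: measurable_funM; [exact: (measurableT_comp mh1)|exact: (measurableT_comp mh2)].
have mEf : measurable_fun setT (EFin \o f) by exact/measurable_EFinP.
have intf : (m1 \x m2)%E.-integrable setT (EFin \o f).
  apply/integrable12ltyP => //.
  under eq_integral => x _.
    under eq_integral do rewrite /= /f /= normrM EFinM.
    rewrite ge0_integralZl//; last first.
      by apply/measurable_EFinP; exact: measurableT_comp.
    over.
  rewrite ge0_integralZr//; last 2 first.
  - by apply/measurable_EFinP; exact: measurableT_comp.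
  - by apply: integral_ge0 => x _; rewrite lee_fin.
  by case/integrableP: i1 => _ j1; case/integrableP: i2 => _ j2;
    rewrite lte_mul_pinfty// ?integral_ge0// ge0_fin_numE// integral_ge0.
have intP : P.-integrable setT ((EFin \o f) \o Y).
  apply/integrableP; split; first exact: measurableT_comp.
  rewrite (_ : (\int[P]_x _ = \int[m1]_x \int[m2]_y (abse (EFin (f (x, y)))))%E).
    exact: (integrable12ltyP m1 m2 mEf).1.
  by apply: (ge0_integral_joint_law (f := fun z => abse (EFin (f z)))) => //;
    exact: measurableT_comp.
split; first exact: intP.
rewrite -[LHS]/(\int[P]_(w in Y @^-1` setT) ((EFin \o f) \o Y) w)%E.
rewrite -(integral_pushforward mY (mu := P) (D := setT) mEf)//.
rewrite (eq_measure_integral (m1 \x m2)%E); last first.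
  by move=> A mA _; exact: joint_lawE.
rewrite -integral21_prod_meas1// /fubini_G.
under eq_integral => y _.
  rewrite /= /f /=; under eq_integral do rewrite EFinM.
  rewrite integralZr//.
  rewrite -[X in (X * _)%E]fineK; last first.
    by apply: integrable_fin_num.
  rewrite -[fine _]/(\int[m1]_x h1 x) h10 mul0e.
  over.
by rewrite integral0.
Qed.

End joint_law.

Section pairwise_chebyshev.
Context (R : realType) (d d' : measure_display) (T : measurableType d)
  (S : measurableType d') (P : probability T R) (n : nat)
  (m : 'I_n -> probability S R)
  (Y : 'I_n -> T -> S) (h : 'I_n -> S -> R) (V : 'I_n -> R).
Hypothesis mY : forall i, measurable_fun setT (Y i).
Hypothesis Y1 : forall i A, measurable A -> P (Y i @^-1` A) = m i A.
Hypothesis Y2 : forall i j A B, i != j -> measurable A -> measurable B ->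
  P (Y i @^-1` A `&` Y j @^-1` B) = (m i A * m j B)%E.
Hypothesis ih : forall i, (m i).-integrable setT (EFin \o h i).
Hypothesis h0 : forall i, \int[m i]_x h i x = 0.
Hypothesis h2 : forall i, (\int[m i]_x (h i x ^+ 2)%:E <= (V i)%:E)%E.

(** The second moment of the sum expands into pairs, and the pairs with [i != j] vanish because the
    summands are centred and pairwise independent. *)
Lemma pairwise_chebyshev (r : R) : 0 < r ->
  (P [set w | (r <= `|\sum_(i < n) h i (Y i w)|)%R] <=
   ((\sum_(i < n) V i) / r ^+ 2)%:E)%E.
Proof.
move=> r0.
have mh i : measurable_fun setT (h i).
  by apply/measurable_EFinP; exact: measurable_int (ih i).
pose G i w := h i (Y i w).
have mG i : measurable_fun setT (G i) by exact: measurableT_comp.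
have G2 i : (\int[P]_w (G i w ^+ 2)%:E <= (V i)%:E)%E.
  apply: le_trans (h2 i); pose f x := (h i x ^+ 2)%:E.
  have mf : measurable_fun setT f.
    by apply/measurable_EFinP; exact: measurable_funX.
  rewrite -[leLHS]/(\int[P]_(w in Y i @^-1` setT) (f \o Y i) w)%E.
  rewrite -(ge0_integral_pushforward (mY i) P (D := setT))//; last first.
    by move=> x _; rewrite lee_fin sqr_ge0.
  rewrite (eq_measure_integral (m i))// => A mA _.
  exact: Y1.
have iG2 i : P.-integrable setT (EFin \o (fun w => G i w ^+ 2)).
  apply/integrableP; split.
    by apply/measurable_EFinP; exact: measurable_funX.
  apply: le_lt_trans (ltry (V i)); apply: le_trans (G2 i).
  rewrite le_eqVlt; apply/orP; left; apply/eqP; apply: eq_integral => w _ /=.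
  by rewrite ger0_norm// sqr_ge0.
have GG i j : P.-integrable setT (EFin \o (fun w => G i w * G j w)) /\
    (\int[P]_w (G i w * G j w)%:E <= (if i == j then V i else 0)%:E)%E.
  have [<-|ij] := eqVneq i j; first by split; [exact: iG2|exact: G2].
  have [a b] := integral_joint_lawM0 (mY i) (mY j)
    (fun A B mA mB => Y2 ij mA mB) (ih i) (ih j) (h0 i).
  by split => //; rewrite b.
pose Z w := \sum_(i < n) G i w.
have SE : (\int[P]_w (Z w ^+ 2)%:E <= (\sum_(i < n) V i)%:E)%E.
  rewrite (_ : (fun w => (Z w ^+ 2)%:E) =
     (fun w => \sum_(i < n) \sum_(j < n) (G i w * G j w)%:E)%E); last first.
    apply/funext => w; rewrite expr2 /Z big_distrlr/= -sumEFin.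
    by apply: eq_bigr => i _; rewrite -sumEFin.
  rewrite integral_sum//; last first.
    move=> i; apply: integrable_sum => // j _; exact: (GG i j).1.
  rewrite -sumEFin; apply: lee_sum => i _.
  rewrite integral_sum//; last by move=> j; exact: (GG i j).1.
  apply: le_trans (lee_sum _ (fun j _ => (GG i j).2)) _.
  by rewrite sumEFin -big_mkcond/= (big_pred1 i)// => j; rewrite eq_sym.
have mZ : measurable_fun setT Z by exact: measurable_sum.
rewrite EFinM lee_pdivlMr ?exprn_gt0// muleC.
apply: le_trans SE.
have mA : measurable [set w | r <= `|Z w|].
  rewrite -[X in measurable X]setTI.
  have mnZ : measurable_fun setT (fun w => `|Z w|) by exact: measurableT_comp.
  have := mnZ measurableT [set x | r <= x].
  by apply; rewrite -[X in measurable X]set_itvcy; exact: measurable_itv.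
rewrite -integral_cst//.
apply: (@le_trans _ _ (\int[P]_(w in [set w | (r <= `|Z w|)%R]) (Z w ^+ 2)%:E)%E).
  apply: ge0_le_integral => //.
  - by move=> x _; rewrite lee_fin sqr_ge0.
  - by apply/measurable_EFinP/measurable_funTS; exact: measurable_funX.
  - move=> w /= rw; rewrite lee_fin -(real_normK (num_real (Z w))).
    by rewrite ler_sqr ?nnegrE// ltW.
apply: ge0_subset_integral => //.
  by apply/measurable_EFinP; exact: measurable_funX.
by move=> w _; rewrite lee_fin sqr_ge0.
Qed.

End pairwise_chebyshev.

Section product_law_marginals.
Context (R : realType) (d d' : measure_display) (S : measurableType d)
  (T : measurableType d') (P : probability T R) (n : nat)
  (X : {mfun T >-> n.-tuple S}) (m : 'I_n -> set S -> \bar R).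
Hypothesis m_setT : forall i, m i setT = 1%E.
Hypothesis Xm : product_law (distribution P X) m.

Lemma product_law_marginal i A : measurable A ->
  P ((fun w => tnth (X w) i) @^-1` A) = m i A.
Proof.
move=> mA; have := Xm (A := fun k => if k == i then A else setT).
rewrite (bigD1 i)//= eqxx big1 ?mule1; last first.
  by move=> k /negbTE ->; rewrite m_setT.
move=> <-; last by move=> k; case: ifP.
rewrite /distribution /pushforward; congr (P _); apply/funext => w.
apply/propext; split=> /= [Aw k|/(_ i)]; last by rewrite eqxx.
by case: eqP => [->|].
Qed.

Lemma product_law_pair i j A B : i != j -> measurable A -> measurable B ->
  P ((fun w => tnth (X w) i) @^-1` A `&` (fun w => tnth (X w) j) @^-1` B) =
  (m i A * m j B)%E.
Proof.
move=> ij mA mB; have ji : j != i by rewrite eq_sym.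
have := Xm (A := fun k => if k == i then A else if k == j then B else setT).
rewrite (bigD1 i)//= eqxx (bigD1 j)//= (negbTE ji) eqxx big1 ?mule1; last first.
  by move=> k /andP[/negbTE -> /negbTE ->]; rewrite m_setT.
move=> <-; last by move=> k; case: ifP => // _; case: ifP.
rewrite /distribution /pushforward; congr (P _); apply/funext => w.
apply/propext; split=> /= [[Aw Bw] k|Aw].
  by case: eqP => [->//|_]; case: eqP => [->//|].
by have := Aw i; have := Aw j; rewrite !eqxx (negbTE ji).
Qed.

End product_law_marginals.

(** * Concentration of the Gaussian data *)

Section gaussian_concentration.
Context (R : realType) (d : measure_display) (T : measurableType d)
  (P : probability T R) (n : nat) (theta : n.-tuple R) (sigma : R)
  (X : {mfun T >-> n.-tuple R}).
Hypothesis sigma_gt0 : 0 < sigma.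
Hypothesis X_gaussian : isotropic_gaussian P theta sigma X.

Let m (i : 'I_n) : probability (measurableTypeR R) R :=
  normal_prob (tnth theta i) sigma.
Let Xm : product_law (distribution P X) m := X_gaussian.
Let m_setT i : m i setT = 1%E. Proof. exact: probability_setT. Qed.
Let m_mean0 i : \int[m i]_x (x - tnth theta i) = 0.
Proof. exact: normal_mean0. Qed.
Let m_moment2 i : \int[m i]_x (x - tnth theta i) ^+ 2 = sigma ^+ 2.
Proof. exact: normal_second_moment. Qed.
Let mX i : measurable_fun setT (fun w => tnth (X w) i).
Proof. exact: measurableT_comp (measurable_tnth i) _. Qed.

Lemma gaussian_linear_concentration (r : R) : 0 < r ->
  (P [set w | (r <= `|\sum_(i < n) tnth theta i * (tnth (X w) i - tnth theta i)|)%R]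
   <= (sigma ^+ 2 * dotprod theta theta / r ^+ 2)%:E)%E.
Proof.
move=> r0.
have -> : sigma ^+ 2 * dotprod theta theta =
    \sum_(i < n) sigma ^+ 2 * (tnth theta i) ^+ 2.
  by rewrite -mulr_sumr; congr (_ * _); apply: eq_bigr => i _; rewrite expr2.
have iz i : (m i).-integrable setT (EFin \o (fun x => x - tnth theta i)).
  exact: (@normal_integrable_pow _ _ _ sigma_gt0 1).
have iz2 i : (m i).-integrable setT (EFin \o (fun x => (x - tnth theta i) ^+ 2)).
  exact: (@normal_integrable_pow _ _ _ sigma_gt0 2).
apply: (pairwise_chebyshev (m := m) (Y := fun i w => tnth (X w) i)
  (h := fun i x => tnth theta i * (x - tnth theta i))) => //.
- by move=> i A mA; exact: (product_law_marginal m_setT Xm).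
- by move=> i j A B ij mA mB; exact: (product_law_pair m_setT Xm).
- move=> i; have := integrableZl measurableT (tnth theta i) (iz i).
  by apply: eq_integrable.
- by move=> i; rewrite (RintegralZl _ measurableT (iz i)) m_mean0 mulr0.
- move=> i; under eq_integral do rewrite exprMn EFinM.
  rewrite (integralZl measurableT (iz2 i)) -[X in (_ * X)%E]fineK; last first.
    exact: (integrable_fin_num measurableT (iz2 i)).
  rewrite -[fine _]/(\int[m i]_x (x - tnth theta i) ^+ 2).
  by rewrite m_moment2 -EFinM mulrC.
Qed.

Lemma gaussian_quadratic_concentration (r : R) : 0 < r ->
  (P [set w | (r <= `|\sum_(i < n) ((tnth (X w) i - tnth theta i) ^+ 2 - sigma ^+ 2)|)%R]
   <= (33 * sigma ^+ 4 * n%:R / r ^+ 2)%:E)%E.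
Proof.
move=> r0.
have -> : 33 * sigma ^+ 4 * n%:R = \sum_(i < n) 33 * sigma ^+ 4.
  by rewrite sumr_const card_ord mulr_natr.
have iz2 i : (m i).-integrable setT (EFin \o (fun x => (x - tnth theta i) ^+ 2)).
  exact: (@normal_integrable_pow _ _ _ sigma_gt0 2).
have ic i (c : R) : (m i).-integrable setT (EFin \o cst c).
  exact: finite_measure_integrable_cst.
apply: (pairwise_chebyshev (m := m) (Y := fun i w => tnth (X w) i)
  (h := fun i x => (x - tnth theta i) ^+ 2 - sigma ^+ 2)) => //.
- by move=> i A mA; exact: (product_law_marginal m_setT Xm).
- by move=> i j A B ij mA mB; exact: (product_law_pair m_setT Xm).
- move=> i; have := integrableB measurableT (iz2 i) (ic i (sigma ^+ 2)).
  by apply: eq_integrable.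
- move=> i; rewrite (RintegralB measurableT (iz2 i) (ic i (sigma ^+ 2))).
  rewrite m_moment2 Rintegral_cst//.
  by rewrite [X in fine X]probability_setT mulr1 subrr.
(* Dropping the cross term [- 2 sigma^2 z^2] of the square leaves the fourth moment plus [sigma^4],
   whence 33 = 32 + 1. *)
- move=> i; apply: (@le_trans _ _ (\int[m i]_x
      (((x - tnth theta i) ^+ 4)%:E + (sigma ^+ 4)%:E))%E).
    have mz : measurable_fun setT (fun x : R => x - tnth theta i).
      exact: measurable_funB.
    apply: ge0_le_integral => //.
    + by move=> x _; rewrite lee_fin sqr_ge0.
    + apply/measurable_EFinP; apply: measurable_funX; apply: measurable_funB => //.
      exact: measurable_funX.
    + by apply: emeasurable_funD => //; apply/measurable_EFinP; exact: measurable_funX.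
    + move=> x _; rewrite -EFinD lee_fin; set z := x - _.
      have : 0 <= z ^+ 2 * sigma ^+ 2 by rewrite mulr_ge0 ?sqr_ge0.
      rewrite (_ : z ^+ 4 = (z ^+ 2) ^+ 2); last by rewrite -exprM.
      by rewrite (_ : sigma ^+ 4 = (sigma ^+ 2) ^+ 2) -?exprM//; nra.
  rewrite ge0_integralD//.
  + rewrite integral_cst// [X in (_ * X)%E]probability_setT mule1.
    rewrite (_ : 33 * sigma ^+ 4 = 32 * sigma ^+ 4 + sigma ^+ 4); last by ring.
    by rewrite EFinD; apply: leeD => //; exact: normal_fourth_moment.
  + by move=> x _; rewrite lee_fin exprn_even_ge0.
  + by apply/measurable_EFinP; apply: measurable_funX; exact: measurable_funB.
  + by move=> x _; rewrite lee_fin exprn_even_ge0.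
Qed.

End gaussian_concentration.

(** * Random codebooks *)

Section finite_unions.
Context (d : measure_display) (T : measurableType d) (R : realType) (N : nat).
Variable A : 'I_N -> set T.
Hypothesis mA : forall i, measurable (A i).

Let existsE : [set x | exists i, A i x] = \big[setU/set0]_(i < N) A i.
Proof.
rewrite -bigcup_seq; apply/funext => x; apply/propext; split=> /= [[i Aix]|[i _ Aix]].
  by exists i => //=; rewrite mem_index_enum.
by exists i.
Qed.

Lemma measurable_exists_ord : measurable [set x | exists i, A i x].
Proof. by rewrite existsE; exact: bigsetU_measurable. Qed.

Lemma measure_exists_ord_le (mu : {measure set T -> \bar R}) :
  (mu [set x | exists i, A i x] <= \sum_(i < N) mu (A i))%E.
Proof.
rewrite existsE; elim: (index_enum _) => [|i s IH].
  by rewrite !big_nil measure0.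
rewrite !big_cons; apply: le_trans (measureU2 _ _ _) _ => //.
  exact: bigsetU_measurable.
exact: leeD.
Qed.

Lemma measurable_forall_ord : measurable [set x | forall i, A i x].
Proof.
rewrite (_ : [set x | _] = \bigcap_(i in setT) A i).
  by apply: fin_bigcap_measurable => //; exact: finite_finset.
by apply/funext => x; apply/propext; split=> [h i _|h i]; exact: h.
Qed.

End finite_unions.

Section measurability.
Context (d : measure_display) (T : measurableType d) (R : realType).

Lemma measurable_set_lt (f g : T -> R) :
  measurable_fun setT f -> measurable_fun setT g -> measurable [set x | f x < g x].
Proof.
move=> mf mg; rewrite (_ : [set x | _] = (fun x => f x < g x) @^-1` [set true]).
  by rewrite -[X in measurable X]setTI; exact: (measurable_fun_ltr mf mg).
by apply/funext => x; apply/propext; split.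
Qed.

Lemma measurable_set_le (f g : T -> R) :
  measurable_fun setT f -> measurable_fun setT g -> measurable [set x | f x <= g x].
Proof.
move=> mf mg; rewrite (_ : [set x | _] = ~` [set x | g x < f x]).
  by apply: measurableC; exact: measurable_set_lt.
by apply/funext => x; apply/propext => /=; rewrite leNgt; split=> /negP.
Qed.

Lemma measurable_enorm n (f : T -> n.-tuple R) :
  measurable_fun setT f -> measurable_fun setT (fun x => enorm (f x)).
Proof.
move=> mf; have -> : (fun x => enorm (f x)) =
    (fun x => dotprod (f x) (f x) `^ (2^-1)).
  by apply/funext => x; rewrite powR12_sqrt ?dotprod_ge0.
apply: (measurableT_comp (measurable_powR _)).
exact: measurable_dotprod.
Qed.

End measurability.

Section codebook.
Context (R : realType) (n N : nat).
Implicit Types (x y theta : n.-tuple R) (C : N.-tuple (n.-tuple R)).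

(** The cosine condition is multiplied out by [enorm x], so that it makes sense at [x = 0], where it
    fails for any nonempty codebook. *)
Definition codebook_misses (t : R) x C :=
  forall i : 'I_N, dotprod x (tnth C i) < t * enorm x.

(* [tnth C i] is close to [x] in direction, but its component along the part
   of [theta] orthogonal to [x] is below [- delta * K]. *)
Definition codebook_deviates (t delta K : R) theta x C :=
  exists i : 'I_N, t * enorm x <= dotprod x (tnth C i) /\
  enorm x ^+ 2 * dotprod theta (tnth C i) - dotprod theta x * dotprod x (tnth C i)
    < - (delta * K * enorm x ^+ 2).

(** A null event that has to be listed: codewords are unit vectors almost surely only, while the
    distortion is bounded outcome by outcome. *)
Definition codebook_off_sphere C := exists i : 'I_N, ~ usphere (tnth C i).

Lemma dotprod_lin x y z (a b : R) :
  dotprod [tuple a * tnth x i + b * tnth y i | i < n] z =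
  a * dotprod x z + b * dotprod y z.
Proof.
rewrite /dotprod !mulr_sumr -big_split/=; apply: eq_bigr => i _.
by rewrite tnth_mktuple; ring.
Qed.

Lemma dotprodZl x z (a : R) :
  dotprod [tuple a * tnth x i | i < n] z = a * dotprod x z.
Proof.
rewrite /dotprod mulr_sumr; apply: eq_bigr => i _.
by rewrite tnth_mktuple mulrA.
Qed.

Lemma enorm_gt0 x : (0 < enorm x) = (dotprod x x != 0).
Proof.
by rewrite -enorm_sqr sqrf_eq0 lt0r sqrtr_ge0 andbT.
Qed.

Section one_codeword.
Variable mu : probability (n.-tuple R) R.
Hypothesis mu_uniform : uniform_sphere mu.
Lemma usphere_normalize x : dotprod x x != 0 ->
  usphere [tuple (enorm x)^-1 * tnth x i | i < n].
Proof.
move=> x0; apply/usphereE; rewrite dotprodZl dotprodC dotprodZl -enorm_sqr.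
by field; rewrite gt_eqF// enorm_gt0.
Qed.

Lemma codeword_hit_ge x (t : R) (j : nat) : 0 < t -> t < 1 -> (0 < n)%N ->
  (n <= (2 * j).+1)%N -> dotprod x x != 0 ->
  (((1 - t ^+ 2) ^+ j.+2 / (32 * n%:R ^+ 2))%:E <=
    mu [set y | (t * enorm x <= dotprod x y)%R])%E.
Proof.
move=> t_gt0 t_lt1 n0 nj x0.
apply: le_trans (sphere_cap_ge mu_uniform (usphere_normalize x0) t_gt0 t_lt1 n0 nj) _.
rewrite le_eqVlt; apply/orP; left; apply/eqP; congr (mu _).
apply/funext => y; apply/propext => /=.
rewrite dotprodZl.
by rewrite ler_pdivlMl ?enorm_gt0// mulrC.
Qed.

Variables (theta x : n.-tuple R) (t delta K s : R) (m : nat).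
Hypotheses (t_gt0 : 0 < t) (delta_ge0 : 0 <= delta) (K_ge0 : 0 <= K)
  (thetaK : dotprod theta theta <= K ^+ 2) (s_gt0 : 0 < s)
  (ts : 1 - (t ^+ 2 + delta ^+ 2) < s) (mn : (2 * m + 3 <= n)%N).

Lemma codeword_deviates_le :
  (mu [set y | (t * enorm x <= dotprod x y)%R /\
     (enorm x ^+ 2 * dotprod theta y - dotprod theta x * dotprod x y
       < - (delta * K * enorm x ^+ 2))%R] <= (n%:R * s ^+ m)%:E)%E.
Proof.
set A := [set y | _].
have b0 : 0 <= n%:R * s ^+ m by rewrite mulr_ge0// exprn_ge0// ltW.
have mx : measurable_fun setT (fun y : n.-tuple R => dotprod x y) by exact: measurable_dotprod.
have mt : measurable_fun setT (fun y : n.-tuple R => dotprod theta y) by exact: measurable_dotprod.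
have mA : measurable A.
  apply: measurableI; first exact: measurable_set_le.
  apply: measurable_set_lt => //.
  by apply: measurable_funB; exact: measurable_funM.
set X := dotprod x x; set p := dotprod theta x; set Q := dotprod theta theta.
have QK : Q <= K ^+ 2 by exact: thetaK.
have XE : enorm x ^+ 2 = X by rewrite enorm_sqr.
(* Two degenerate cases, [x = 0] here and [theta] parallel to [x] below ([D = 0]): the left side of
   the strict inequality defining [A] is then 0 and its right side is at most 0, so [A] is empty. *)
have [X0|X0] := eqVneq X 0.
  rewrite (_ : A = set0) ?measure0 ?lee_fin//.
  apply/seteqP; split => // y [_]; rewrite XE X0 mul0r mulr0 oppr0 sub0r.
  have -> : dotprod x y = 0.
    apply/eqP; rewrite -sqrf_eq0 eq_le sqr_ge0 andbT.
    by apply: le_trans (cauchy_schwarz _ _) _; rewrite -/X X0 mul0r.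
  by rewrite mulr0 oppr0 ltxx.
have Xp : 0 < X by rewrite lt_neqAle eq_sym X0 dotprod_ge0.
set e := enorm x in XE *; have e0 : 0 < e by rewrite enorm_gt0.
pose D := X * Q - p ^+ 2.
have D0 : 0 <= D by rewrite subr_ge0 /p /X /Q mulrC cauchy_schwarz.
have DK : D <= X * K ^+ 2.
  by rewrite lerBlDr (le_trans (ler_wpM2l (ltW Xp) QK))// lerDl sqr_ge0.
(* [th] is the part of [theta] orthogonal to [x], multiplied by [|x|^2] to avoid a division; its
   norm [f] is at most [|x|^2 K]. *)
pose th : n.-tuple R := [tuple X * tnth theta i + (- p) * tnth x i | i < n].
have thE y : dotprod th y = X * dotprod theta y - p * dotprod x y.
  by rewrite dotprod_lin mulNr.
have thth : dotprod th th = X * D.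
  rewrite thE ![dotprod _ th]dotprodC !thE -/Q -/X (dotprodC x theta) -/p /D.
  by ring.
have thx : dotprod th x = 0 by rewrite thE -/p -/X; ring.
have [D00|D00] := eqVneq D 0.
  rewrite (_ : A = set0) ?measure0 ?lee_fin//.
  apply/seteqP; split => // y [_]; rewrite XE -/p -thE.
  have -> : dotprod th y = 0.
    apply/eqP; rewrite -sqrf_eq0 eq_le sqr_ge0 andbT.
    by apply: le_trans (cauchy_schwarz _ _) _; rewrite thth D00 mulr0 mul0r.
  have : 0 <= delta * K * X by rewrite mulr_ge0 ?(ltW Xp)// mulr_ge0.
  by move=> ? ?; exfalso; lra.
pose f := enorm th.
have f2 : f ^+ 2 = X * D by rewrite enorm_sqr thth.
have f0 : 0 < f by rewrite enorm_gt0 thth mulf_neq0.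
have fK : f <= X * K.
  rewrite -ler_sqr ?nnegrE ?(ltW f0) ?mulr_ge0 ?(ltW Xp)//.
  rewrite f2 exprMn [X ^+ 2]expr2 -mulrA.
  by rewrite ler_wpM2l// ltW.
pose r2 := t ^+ 2 + delta ^+ 2; pose r := Num.sqrt r2.
have r20 : 0 < r2 by rewrite ltr_pwDl ?exprn_gt0// sqr_ge0.
have rr : r ^+ 2 = r2 by rewrite sqr_sqrtr// ltW.
have r0 : 0 < r by rewrite sqrtr_gt0.
(* The direction between [x / |x|] and [- th / |th|], with weights [t / r] and [delta / r]. On [A]
   the two components of [y] are at least [t] and [delta], so [dotprod u y] is at least
   [(t^2 + delta^2) / r = r]. *)
pose u : n.-tuple R := [tuple (t / (r * e)) * tnth x i + (- (delta / (r * f))) * tnth th i | i < n].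
have uE y : dotprod u y = (t / (r * e)) * dotprod x y - (delta / (r * f)) * dotprod th y.
  by rewrite dotprod_lin mulNr.
have su : usphere u.
  apply/usphereE; rewrite uE ![dotprod _ u]dotprodC !uE -/X thth (dotprodC x th) thx.
  rewrite !mulr0 subr0 sub0r mulrN opprK -f2 -XE.
  transitivity ((t ^+ 2 + delta ^+ 2) / r ^+ 2).
    by field; rewrite !gt_eqF.
  by rewrite rr divff// gt_eqF.
apply: (@le_trans _ _ (mu [set y | (r <= dotprod u y)%R])).
  apply: le_measure; rewrite ?inE//.
    by apply: measurable_set_le => //; exact: measurable_dotprod.
  move=> y [h1]; rewrite XE -/p -thE => h2 /=.
  rewrite uE.
  have g1 : t / r * t <= t / (r * e) * dotprod x y.
    rewrite [leRHS](_ : _ = t / r * (dotprod x y / e)); last first.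
      by field; rewrite !gt_eqF.
    by rewrite ler_wpM2l ?divr_ge0 ?(ltW t_gt0) ?(ltW r0)// ler_pdivlMr.
  have g2 : delta / r * delta <= - (delta / (r * f) * dotprod th y).
    rewrite [leRHS](_ : _ = delta / r * (- dotprod th y / f)); last first.
      by field; rewrite !gt_eqF.
    rewrite ler_wpM2l ?divr_ge0 ?(ltW r0)// ler_pdivlMr//.
    apply: (@le_trans _ _ (delta * K * X)); last by rewrite lerNr ltW.
    by rewrite -mulrA ler_wpM2l// mulrC.
  apply: le_trans (lerD g1 g2).
  rewrite (_ : _ + _ = r2 / r); last by rewrite /r2; field; rewrite gt_eqF.
  by rewrite -rr expr2 mulfK// gt_eqF.
apply: (sphere_cap_le mu_uniform su s_gt0 (ltW r0)) => //.
by rewrite rr.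
Qed.

End one_codeword.
End codebook.

Section codebook_failure.
Context (R : realType) (d : measure_display) (T : measurableType d)
  (P : probability T R) (n N : nat)
  (X : {mfun T >-> n.-tuple R}) (U : {mfun T >-> N.-tuple (n.-tuple R)})
  (mu : probability (n.-tuple R) R).
Hypotheses (mu_uniform : uniform_sphere mu)
  (U_law : product_law (distribution P U) (fun=> mu))
  (XU : independent_rv P X U).
Variables (theta : n.-tuple R) (t delta K s : R) (m j : nat).
Hypotheses (N_gt0 : (0 < N)%N) (n_gt0 : (0 < n)%N)
  (t_gt0 : 0 < t) (t_lt1 : t < 1) (delta_ge0 : 0 <= delta)
  (K_ge0 : 0 <= K) (thetaK : dotprod theta theta <= K ^+ 2) (s_gt0 : 0 < s)
  (ts : 1 - (t ^+ 2 + delta ^+ 2) < s) (mn : (2 * m + 3 <= n)%N)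
  (nj : (n <= (2 * j).+1)%N).

Let nu : probability (N.-tuple (n.-tuple R)) R := distribution P U.
Let p : R := (1 - t ^+ 2) ^+ j.+2 / (32 * n%:R ^+ 2).

Let mu_setT (i : 'I_N) : mu setT = 1%E. Proof. exact: probability_setT. Qed.

Lemma codeword_law i (A : set (n.-tuple R)) : measurable A ->
  nu [set C | A (tnth C i)] = mu A.
Proof. by move=> mA; rewrite -(product_law_marginal mu_setT U_law i mA). Qed.

Lemma codebook_misses_le (x : n.-tuple R) :
  (nu [set C | codebook_misses t x C] <= (expR (- (N%:R * p)))%:E)%E.
Proof.
have [x0|x0] := eqVneq (dotprod x x) 0.
  rewrite (_ : [set C | _] = set0) ?measure0 ?lee_fin ?expR_ge0//.
  apply/seteqP; split => // C /(_ (Ordinal N_gt0)).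
  have -> : enorm x = 0 by apply/eqP; rewrite -sqrf_eq0 enorm_sqr x0.
  have -> : dotprod x (tnth C (Ordinal N_gt0)) = 0.
    apply/eqP; rewrite -sqrf_eq0 eq_le sqr_ge0 andbT.
    by apply: le_trans (cauchy_schwarz _ _) _; rewrite x0 mul0r.
  by rewrite mulr0 ltxx.
pose A := [set y | dotprod x y < t * enorm x].
have mx : measurable_fun setT (fun y : n.-tuple R => dotprod x y) by exact: measurable_dotprod.
have mA : measurable A by exact: measurable_set_lt.
have pA : (mu A <= (expR (- p))%:E)%E.
  have := codeword_hit_ge mu_uniform t_gt0 t_lt1 n_gt0 nj x0.
  rewrite (_ : [set y | _] = ~` A); last first.
    by apply/funext => y; apply/propext; rewrite /A /= leNgt; split=> /negP.
  rewrite probability_setC// -/p.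
  have /fineK <- : mu A \is a fin_num by exact: fin_num_measure.
  rewrite -EFinB !lee_fin => pmu.
  by have := expR_ge1Dx (- p); lra.
rewrite [leLHS](U_law (fun _ => mA)).
have /fineK <- : mu A \is a fin_num by exact: fin_num_measure.
rewrite prodEFin lee_fin prodr_const card_ord -mulrN expRM_natl.
rewrite lerXn2r ?nnegrE ?expR_ge0 ?fine_ge0//.
by rewrite -lee_fin fineK// fin_num_measure.
Qed.

Lemma codebook_deviates_le (x : n.-tuple R) :
  (nu [set C | codebook_deviates t delta K theta x C] <=
    (N%:R * (n%:R * s ^+ m))%:E)%E.
Proof.
pose A := [set y | (t * enorm x <= dotprod x y)%R /\
     (enorm x ^+ 2 * dotprod theta y - dotprod theta x * dotprod x y
       < - (delta * K * enorm x ^+ 2))%R].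
have mx : measurable_fun setT (fun y : n.-tuple R => dotprod x y) by exact: measurable_dotprod.
have mt : measurable_fun setT (fun y : n.-tuple R => dotprod theta y) by exact: measurable_dotprod.
have mA : measurable A.
  apply: measurableI; first exact: measurable_set_le.
  apply: measurable_set_lt => //.
  by apply: measurable_funB; exact: measurable_funM.
have mAi i : measurable [set C : N.-tuple (n.-tuple R) | A (tnth C i)].
  by rewrite -[X in measurable X]setTI; exact: measurable_tnth.
apply: le_trans (measure_exists_ord_le mAi nu) _.
apply: (@le_trans _ _ (\sum_(i < N) (n%:R * s ^+ m)%:E)%E); last first.
  by rewrite sumEFin sumr_const card_ord [X in (_ <= X%:E)%E]mulr_natl.
apply: lee_sum => i _; rewrite [leLHS](codeword_law i mA).
exact: codeword_deviates_le.
Qed.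

Lemma codebook_off_sphere0 : nu [set C | codebook_off_sphere C] = 0%E.
Proof.
have mS : measurable (~` @usphere R n).
  by apply: measurableC; exact: measurable_usphere.
have mAi i : measurable [set C : N.-tuple (n.-tuple R) | (~` @usphere R n) (tnth C i)].
  by rewrite -[X in measurable X]setTI; exact: measurable_tnth.
apply/eqP; rewrite eq_le measure_ge0 andbT.
apply: le_trans (measure_exists_ord_le mAi nu) _.
rewrite big1// => i _; rewrite [LHS](codeword_law i mS).
rewrite probability_setC; last exact: measurable_usphere.
by rewrite mu_uniform.1 subee.
Qed.

Definition codebook_fails (x : n.-tuple R) (C : N.-tuple (n.-tuple R)) :=
  [\/ codebook_misses t x C, codebook_deviates t delta K theta x C |
      codebook_off_sphere C].

Let Z : Type := (n.-tuple R * N.-tuple (n.-tuple R))%type.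

Let measurable_misses : measurable [set z : Z | codebook_misses t z.1 z.2].
Proof.
apply: measurable_forall_ord => i; apply: measurable_set_lt.
  apply: measurable_dotprod => //.
  exact: (measurableT_comp (measurable_tnth i) measurable_snd).
by apply: measurable_funM => //; exact: measurable_enorm.
Qed.

Let measurable_deviates :
  measurable [set z : Z | codebook_deviates t delta K theta z.1 z.2].
Proof.
have m1 : measurable_fun setT (fun z : Z => enorm z.1) by exact: measurable_enorm.
have mw i : measurable_fun setT (fun z : Z => tnth z.2 i).
  exact: (measurableT_comp (measurable_tnth i) measurable_snd).
have mxw i : measurable_fun setT (fun z : Z => dotprod z.1 (tnth z.2 i)).
  exact: measurable_dotprod.
apply: measurable_exists_ord => i; apply: measurableI.
  by apply: measurable_set_le => //; exact: measurable_funM.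
apply: measurable_set_lt.
  apply: measurable_funB; apply: measurable_funM => //.
  - exact: measurable_funX.
  - exact: measurable_dotprod.
  - exact: measurable_dotprod.
apply: measurable_funN; apply: measurable_funM => //.
exact: measurable_funX.
Qed.

Let measurable_off_sphere : measurable [set z : Z | codebook_off_sphere z.2].
Proof.
apply: measurable_exists_ord => i; rewrite -[X in measurable X]setTI.
have mS : measurable (~` @usphere R n).
  by apply: measurableC; exact: measurable_usphere.
exact: (measurableT_comp (measurable_tnth i) measurable_snd measurableT mS).
Qed.

Let F := [set z : Z | codebook_misses t z.1 z.2] `|`
   [set z | codebook_deviates t delta K theta z.1 z.2] `|`
   [set z | codebook_off_sphere z.2].

Let mF : measurable F.
Proof. by apply: measurableU => //; exact: measurableU. Qed.

Let failsE : [set w | codebook_fails (X w) (U w)] = (fun w => (X w, U w)) @^-1` F.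
Proof.
apply/funext => w; apply/propext; rewrite /F; split=> /=.
  by case=> h; [left; left|left; right|right].
by case=> [[h|h]|h]; [apply: Or31|apply: Or32|apply: Or33].
Qed.

Lemma measurable_codebook_fails :
  measurable [set w | codebook_fails (X w) (U w)].
Proof.
rewrite failsE -[X in measurable X]setTI.
have mXU : measurable_fun setT (fun w => (X w, U w)) by exact: measurable_fun_pair.
exact: mXU.
Qed.

(** By independence the joint law of data and codebook is a product, so bounds that hold for each
    fixed [x], uniformly in [x], integrate over the sections of [F]. *)
Lemma codebook_failure :
  (P [set w | codebook_fails (X w) (U w)] <=
    (expR (- (N%:R * p)) + N%:R * (n%:R * s ^+ m))%:E)%E.
Proof.
pose mX : probability (n.-tuple R) R := distribution P X.
rewrite failsE.
rewrite (joint_lawE (m1 := mX) (m2 := nu) _ _ XU)//.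
set b := (expR _ + _)%R.
have sM x : [set C | codebook_misses t x C] =
    xsection [set z : Z | codebook_misses t z.1 z.2] x.
  by apply/funext => C; apply/propext; rewrite xsectionP.
have sD x : [set C | codebook_deviates t delta K theta x C] =
    xsection [set z : Z | codebook_deviates t delta K theta z.1 z.2] x.
  by apply/funext => C; apply/propext; rewrite xsectionP.
have sO x : [set C | codebook_off_sphere C] =
    xsection [set z : Z | codebook_off_sphere z.2] x.
  by apply/funext => C; apply/propext; rewrite xsectionP.
have b0 : 0 <= b.
  by rewrite addr_ge0 ?expR_ge0// mulr_ge0// mulr_ge0// exprn_ge0// ltW.
apply: (@le_trans _ _ (\int[mX]_x (cst b%:E x))%E); last first.
  by rewrite integral_cst// [X in (_ * X)%E]probability_setT mule1.
apply: ge0_le_integral => //.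
  exact: measurable_fun_xsection.
move=> x _ /=; have -> : xsection F x = [set C | codebook_misses t x C] `|`
    [set C | codebook_deviates t delta K theta x C] `|`
    [set C | codebook_off_sphere C].
  by apply/funext => C; apply/propext; rewrite xsectionP.
apply: le_trans (measureU2 _ _ _) _.
- by apply: measurableU; [rewrite sM|rewrite sD]; exact: measurable_xsection.
- by rewrite (sO x); exact: measurable_xsection.
rewrite [X in (_ + X)%E]codebook_off_sphere0 adde0.
apply: le_trans (measureU2 _ _ _) _.
- by rewrite sM; exact: measurable_xsection.
- by rewrite sD; exact: measurable_xsection.
rewrite EFinD; apply: leeD; first exact: codebook_misses_le.
exact: codebook_deviates_le.
Qed.

End codebook_failure.

(** * From the good event to the distortion bound *)

Section real_bounds.
Variable R : realType.

(* All quantities are normalized: [b0 = |theta|^2/n], [r = |x|^2/n],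
   [a = <theta,x>/n], [h] is the cosine between [x] and the codeword, [g] is
   the component of [theta] along the codeword divided by [sqrt n], and [w] is
   the normalized length of the estimate. *)
Definition linear_distortion_bound (sigma c T k1 k2 C : R) :=
  forall eps b0 b r a h t g w delta : R,
    0 <= eps -> eps <= 1 -> 6 * eps <= sigma ^+ 2 ->
    0 <= b0 -> b0 <= c ^+ 2 -> 0 < b -> `|b - b0| <= 7 * eps ->
    `|r - (b0 + sigma ^+ 2)| <= 3 * eps -> `|a - b0| <= eps ->
    t <= h -> 0 <= h -> h <= 1 -> T - k1 * eps <= t -> delta <= k2 * eps ->
    a * h / Num.sqrt r - delta * c <= g ->
    0 <= w -> w ^+ 2 = b ^+ 2 * T ^+ 2 / (b + sigma ^+ 2) ->
    b0 - 2 * w * g + w ^+ 2 <=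
      sigma ^+ 2 * c ^+ 2 / (sigma ^+ 2 + c ^+ 2)
      + c ^+ 4 / (sigma ^+ 2 + c ^+ 2) * (1 - T ^+ 2) + C * eps.

(** Up to [O(eps)], [2 w g] is at least [2 T^2 b b0 / W] with [W = b + S], and [w^2 = T^2 b^2 / W].
    Completing the square leaves [b0 - T^2 b0^2 / (b0 + S)], as [(b - b0)^2] is also [O(eps)]. For
    [T <= 1] this is nondecreasing in [b0], and its value at [b0 = c^2] is the stated limit. *)
Lemma distortion_bound (sigma c T k1 k2 : R) :
  0 < sigma -> 0 < c -> 0 <= T -> T <= 1 -> 0 <= k1 -> 0 <= k2 ->
  exists C, linear_distortion_bound sigma c T k1 k2 C.
Proof.
rewrite /linear_distortion_bound => s0 c0 T0 T1 k10 k20.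
have s2 : 0 < sigma ^+ 2 by rewrite exprn_gt0.
have c2 : 0 < c ^+ 2 by rewrite exprn_gt0.
set S := sigma ^+ 2 in s2 *; set c' := c ^+ 2 in c2 *.
(* [k3], [k4], [k5] and [k6] bound the errors, in units of [eps], made on [a h], on [g], on [2 w g]
   and on the whole expression. *)
pose k3 := c' * k1 + 1; pose k4 := 2 * k3 / sigma + k2 * c.
pose k5 := 2 * (c' + 8) * k4 + 10 * (c' + 7) * c' / S ^+ 2.
pose k6 := k5 + 49 / S + 7 * c' ^+ 2 / S ^+ 2.
have S2 : 0 < S ^+ 2 by rewrite exprn_gt0.
have k30 : 0 <= k3 by rewrite addr_ge0// mulr_ge0// ltW.
have k40 : 0 <= k4.
  have a1 : 0 <= 2 * k3 / sigma by rewrite divr_ge0 ?(ltW s0)// mulr_ge0.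
  have a2 : 0 <= k2 * c by rewrite mulr_ge0// ltW.
  exact: addr_ge0.
exists k6 => e b0 b r a h t g w delta e0 e1 e6 b00 b0c bp.
rewrite !ler_norml => /andP[bl bu] /andP[rl ru] /andP[al au] th h0 h1 tT dk gh w0 w2.
have ee : e ^+ 2 <= e by nra.
have rp : sigma ^+ 2 / 4 <= r by rewrite -/S; lra.
have r0 : 0 < r by apply: lt_le_trans rp; rewrite divr_gt0.
set q := Num.sqrt r in gh.
have q0 : 0 < q by rewrite sqrtr_gt0.
have qq : q ^+ 2 = r by rewrite sqr_sqrtr// ltW.
have qs : sigma / 2 <= q.
  rewrite -ler_sqr ?nnegrE ?(ltW q0) ?divr_ge0 ?(ltW s0)// qq.
  by rewrite expr_div_n; apply: le_trans rp; rewrite ler_wpM2l ?(ltW s2)//; lra.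
have ah : b0 * T - k3 * e <= a * h.
  have : (b0 - e) * h <= a * h by rewrite ler_wpM2r//; lra.
  have : b0 * (T - k1 * e) <= b0 * h by rewrite ler_wpM2l//; lra.
  have : b0 * (k1 * e) <= c' * (k1 * e) by rewrite ler_wpM2r// mulr_ge0.
  have : e * h <= e by rewrite ler_piMr.
  by rewrite /k3; lra.
have gk : b0 * T / q - k4 * e <= g.
  apply: le_trans gh; have : (b0 * T - k3 * e) / q <= a * h / q.
    by rewrite ler_wpM2r// invr_ge0 ltW.
  have : k3 * e / q <= k3 * e * (2 / sigma).
    rewrite ler_wpM2l ?mulr_ge0// -[2 / sigma]invf_div lef_pV2 ?posrE//.
    by rewrite divr_gt0.
  have : delta * c <= k2 * e * c by rewrite ler_wpM2r// ltW.
  by rewrite /k4 mulrBl; lra.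
pose W := b + S; have W0 : 0 < W by rewrite addr_gt0.
pose V := Num.sqrt W; have V0 : 0 < V by rewrite sqrtr_gt0.
have VV : V ^+ 2 = W by rewrite sqr_sqrtr// ltW.
have wE : w = b * T / V.
  apply/eqP; rewrite -(eqrXn2 (ltn0Sn 1))//; last first.
    by rewrite divr_ge0 ?(ltW V0)// mulr_ge0// ltW.
  by rewrite w2 expr_div_n VV exprMn.
have b7 : b <= c' + 7 by lra.
have w8 : w <= c' + 8.
  have : w ^+ 2 <= b.
    rewrite w2 -/W ler_pdivrMr// expr2 -mulrA ler_wpM2l ?(ltW bp)//.
    have : b * T ^+ 2 <= b * 1.
      by rewrite ler_wpM2l ?(ltW bp)// exprn_ile1.
    by rewrite /W; lra.
  by nra.
(* The mean of [V^2 = W] and [q^2 = r] bounds [V q], and [r <= W + 10 e] since [r] is within [3 e]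
   of [b0 + S] and [b] within [7 e] of [b0]. *)
have Vq : V * q <= W + 5 * e.
  have : 0 <= (V - q) ^+ 2 by exact: sqr_ge0.
  by rewrite sqrrB VV qq /W; lra.
have bT0 : 0 <= b * b0 * T ^+ 2.
  by rewrite !mulr_ge0 ?sqr_ge0// ltW.
have bT1 : b * b0 * T ^+ 2 <= (c' + 7) * c'.
  have T2 : T ^+ 2 <= 1 by rewrite exprn_ile1.
  apply: (@le_trans _ _ (b * b0 * 1)).
    by rewrite ler_wpM2l// mulr_ge0// ltW.
  by rewrite mulr1 ler_pM// ltW.
have iVq : W^-1 - 5 * e / S ^+ 2 <= (V * q)^-1.
  apply: (@le_trans _ _ (W + 5 * e)^-1); last first.
    by rewrite lef_pV2 ?posrE ?mulr_gt0//; lra.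
  have We : 0 < W + 5 * e by lra.
  rewrite lerBlDr -lerBlDl.
  rewrite (_ : W^-1 - (W + 5 * e)^-1 = 5 * e * (W * (W + 5 * e))^-1); last first.
    by field; rewrite !gt_eqF.
  rewrite ler_wpM2l ?mulr_ge0// lef_pV2 ?posrE ?mulr_gt0// expr2.
  by apply: ler_pM; rewrite ?(ltW s2)// /W; lra.
have wg : 2 * (b * b0 * T ^+ 2) / W - k5 * e <= 2 * w * g.
  have : 2 * w * (b0 * T / q - k4 * e) <= 2 * w * g.
    by rewrite ler_wpM2l// mulr_ge0.
  have : w * (k4 * e) <= (c' + 8) * (k4 * e) by rewrite ler_wpM2r// mulr_ge0.
  have : b * b0 * T ^+ 2 * (W^-1 - 5 * e / S ^+ 2) <= b * b0 * T ^+ 2 * (V * q)^-1.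
    by rewrite ler_wpM2l.
  have : b * b0 * T ^+ 2 * (5 * e / S ^+ 2) <= (c' + 7) * c' * (5 * e / S ^+ 2).
    by rewrite ler_wpM2r// divr_ge0 ?(ltW S2)// mulr_ge0.
  have : 2 * w * (b0 * T / q) = 2 * (b * b0 * T ^+ 2 * (V * q)^-1).
    by rewrite wE; field; rewrite !gt_eqF.
  by rewrite /k5; lra.
have bW : b0 ^+ 2 / (b0 + S) - 7 * c' ^+ 2 / S ^+ 2 * e <= b0 ^+ 2 / W.
  have B0 : 0 < b0 + S by lra.
  rewrite lerBlDr -lerBlDl.
  rewrite (_ : _ - _ = b0 ^+ 2 * (b - b0) * ((b0 + S) * W)^-1); last first.
    by rewrite /W; field; rewrite !gt_eqF// -/W.
  have i0 : 0 <= ((b0 + S) * W)^-1 by rewrite invr_ge0 mulr_ge0 ?ltW.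
  have i1 : ((b0 + S) * W)^-1 <= (S ^+ 2)^-1.
    rewrite lef_pV2 ?posrE ?mulr_gt0// expr2.
    by apply: ler_pM; rewrite ?(ltW s2)// /W; lra.
  have n1 : b0 ^+ 2 * (b - b0) <= c' ^+ 2 * (7 * e).
    apply: (@le_trans _ _ (b0 ^+ 2 * (7 * e))).
      by rewrite ler_wpM2l ?sqr_ge0.
    by rewrite ler_wpM2r ?mulr_ge0// lerXn2r ?nnegrE// ltW.
  apply: le_trans (ler_wpM2r i0 n1) _.
  apply: (@le_trans _ _ (c' ^+ 2 * (7 * e) * (S ^+ 2)^-1)); last lra.
  by rewrite ler_wpM2l// mulr_ge0 ?sqr_ge0// mulr_ge0.
have T2 : T ^+ 2 <= 1 by rewrite exprn_ile1.
have T20 := sqr_ge0 T.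
have d2 : (b - b0) ^+ 2 / W <= 49 / S * e.
  rewrite [leRHS]mulrAC; apply: ler_pM; rewrite ?sqr_ge0 ?invr_ge0 ?(ltW W0)//.
    have : 0 <= (7 * e - (b - b0)) * (7 * e + (b - b0)) by rewrite mulr_ge0//; lra.
    by move: ee; lra.
  by rewrite lef_pV2 ?posrE// /W; lra.
have mid : b0 - 2 * w * g + w ^+ 2 <= b0 - T ^+ 2 * (b0 ^+ 2 / (b0 + S)) + k6 * e.
  have E : w ^+ 2 = T ^+ 2 * ((b - b0) ^+ 2 / W) + 2 * (b * b0 * T ^+ 2) / W -
     T ^+ 2 * (b0 ^+ 2 / W).
    by rewrite w2 -/W; field; rewrite gt_eqF.
  have p1 : T ^+ 2 * ((b - b0) ^+ 2 / W) <= 49 / S * e.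
    apply: le_trans d2; rewrite ler_piMl// divr_ge0 ?sqr_ge0// ltW//.
  have p2 := ler_wpM2l T20 bW.
  have p3 : T ^+ 2 * (7 * c' ^+ 2 / S ^+ 2 * e) <= 7 * c' ^+ 2 / S ^+ 2 * e.
    by rewrite ler_piMl// mulr_ge0// divr_ge0 ?(ltW S2)// mulr_ge0 ?sqr_ge0.
  by rewrite /k6; lra.
apply: le_trans mid _; rewrite lerD2r.
have B0 : 0 < b0 + S by lra.
have C0 : 0 < S + c' by lra.
rewrite (_ : c ^+ 4 = c' ^+ 2); last by rewrite -exprM.
rewrite (_ : S * c' / _ + _ = c' - T ^+ 2 * (c' ^+ 2 / (S + c'))); last first.
  by field; rewrite gt_eqF.
have E1 : b0 ^+ 2 / (b0 + S) = b0 - S + S ^+ 2 / (b0 + S).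
  by field; rewrite gt_eqF.
have E2 : c' ^+ 2 / (S + c') = c' - S + S ^+ 2 / (S + c').
  by field; rewrite gt_eqF.
have inv : S ^+ 2 / (S + c') <= S ^+ 2 / (b0 + S).
  by rewrite ler_wpM2l ?(ltW S2)// lef_pV2 ?posrE//; lra.
have : T ^+ 2 * (c' ^+ 2 / (S + c') - b0 ^+ 2 / (b0 + S)) <= 1 * (c' - b0).
  apply: (@le_trans _ _ (T ^+ 2 * (c' - b0))).
    by rewrite ler_wpM2l// E1 E2; lra.
  by rewrite ler_wpM2r// subr_ge0.
by lra.
Qed.

End real_bounds.

Section halves.
Variable n : nat.

(** The rounded exponents are [n./2] in the lower cap bound and [(n - 3)./2] in the upper one;
    rounding costs only bounded powers of [q]. *)
Lemma double_half_le : (2 * n./2 <= n)%N.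
Proof. lia. Qed.

Lemma leq_double_halfS : (n <= (2 * n./2).+1)%N.
Proof. lia. Qed.

Lemma leq_double_half_add2 : (n <= 2 * (n./2).+2)%N.
Proof. lia. Qed.

Hypothesis n8 : (8 <= n)%N.

Lemma double_half_subn3_le : (2 * (n - 3)./2 + 3 <= n)%N.
Proof. lia. Qed.

Lemma leq_double_half_subn3 : (n <= 2 * (n - 3)./2 + 4)%N.
Proof. lia. Qed.

Lemma leq_quadruple_half_subn3 : (n <= 4 * (n - 3)./2)%N.
Proof. lia. Qed.

End halves.

(** * Rates of the codebook failure probabilities *)

Section codebook_numerics.
Variable R : realType.

Lemma expR_half_le (y : R) : 0 <= y -> y <= 1 -> expR (y / 2) <= 1 + y.
Proof.
move=> y0 y1; have := expR_ge1Dx (- (y / 2)); rewrite expRN.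
have e0 := expR_gt0 (y / 2); set e := expR _ in e0 * => h.
have := ler_wpM2r (ltW e0) h; rewrite mulVf ?gt_eqF// => h1.
by nra.
Qed.

Lemma expRN_le_inv (x : R) : 0 < x -> expR (- x) <= x^-1.
Proof.
move=> x0; rewrite expRN lef_pV2 ?posrE ?expR_gt0//.
by have := expR_ge1Dx x; lra.
Qed.

Lemma ln_le_self (x : R) : 0 < x -> ln x <= x.
Proof. by move=> x0; exact: ltW (ln_sublinear x0). Qed.

Lemma codebook_size_le (n : nat) (B : R) :
  (codebook_size n B)%:R <= 2 `^ (n%:R * B).
Proof. by rewrite Num.Theory.truncn_le powR_ge0. Qed.

Lemma codebook_size_ge (n : nat) (B : R) : 2 <= 2 `^ (n%:R * B) :> R ->
  2 `^ (n%:R * B) / 2 <= (codebook_size n B)%:R.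
Proof.
move=> E2; have := Num.Theory.truncnS_gt (2 `^ (n%:R * B)).
by rewrite -/(codebook_size n B) -(natr1 (codebook_size n B)); lra.
Qed.

Section estimates.
Variables (n : nat) (B : R).
Let q : R := 2 `^ (- 2 * B).
Let eps2 : R := ln n%:R / n%:R.
Let N := codebook_size n B.
Hypotheses (B_ge0 : 0 <= B) (n8 : (8 <= n)%N) (L1 : 1 <= ln n%:R :> R)
  (eps_le : 12 * eps2 <= 1) (E2 : 2 <= 2 `^ (n%:R * B) :> R).

Let q0 : 0 < q. Proof. exact: powR_gt0. Qed.

Let qX k : 2 `^ (n%:R * B) * q ^+ k = 2 `^ ((n%:R - 2 * k%:R) * B).
Proof.
rewrite -powR_mulrn ?powR_ge0// -powRrM -powRD; last by rewrite pnatr_eq0 implybT.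
by congr (_ `^ _); ring.
Qed.

Let n0 : 0 < n%:R :> R. Proof. by rewrite ltr0n; exact: leq_trans n8. Qed.
Let L0 : 0 < ln n%:R :> R. Proof. by apply: lt_le_trans L1. Qed.
Let eps0 : 0 <= eps2. Proof. by rewrite divr_ge0// ltW. Qed.
Let exp_ln k : expR (ln n%:R * k%:R) = n%:R ^+ k :> R.
Proof. by rewrite expRM_natr lnK// posrE. Qed.

(** The number of codewords compensates [q^(n/2)] up to a constant. The factor
    [(1 + 12 eps2)^(n/2 + 2)] is at least [exp (3 ln n) = n^3], so the expected number of hits is at
    least [q^2 n / 64], and [exp (- y) <= 1 / y] concludes. *)
Lemma misses_le :
  expR (- (N%:R * ((q * (1 + 12 * eps2)) ^+ (n./2).+2 / (32 * n%:R ^+ 2)))) <=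
  64 / q ^+ 2 / ln n%:R.
Proof.
set p := _ / (32 * _).
have a1 : 1 <= 2 `^ (n%:R * B) * q ^+ n./2.
  rewrite qX; apply: (@le_trans _ _ (2 `^ 0)); first by rewrite powRr0.
  apply: ler_powR; first by rewrite ler1n.
  rewrite mulr_ge0// subr_ge0.
  by rewrite -natrM ler_nat double_half_le.
have a2 : n%:R ^+ 3 <= (1 + 12 * eps2) ^+ (n./2).+2.
  rewrite -exp_ln; apply: (@le_trans _ _ (expR (12 * eps2 / 2 * (n./2).+2%:R))).
    rewrite ler_expR /eps2.
    have h : n%:R <= 2 * (n./2).+2%:R :> R by rewrite -natrM ler_nat leq_double_half_add2.
    rewrite (_ : 12 * _ / 2 * _ = ln n%:R * 3 * (2 * (n./2).+2%:R / n%:R)); last first.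
      by field; rewrite gt_eqF.
    by rewrite ler_peMr ?mulr_ge0 ?(ltW L0)// ler_pdivlMr// mul1r.
  rewrite expRM_natr lerXn2r ?nnegrE ?expR_ge0//.
    by rewrite addr_ge0// mulr_ge0.
  exact: (expR_half_le (mulr_ge0 (ler0n _ 12) eps0) eps_le).
have a3 : q ^+ 2 * n%:R / 64 <= N%:R * p.
  have NE := codebook_size_ge E2.
  apply: (@le_trans _ _ (2 `^ (n%:R * B) / 2 * p)); last first.
    have pn : 0 <= (q * (1 + 12 * eps2)) ^+ (n./2).+2.
      by rewrite exprn_ge0// mulr_ge0 ?(ltW q0)// addr_ge0// mulr_ge0.
    have pd : 0 <= 32 * n%:R ^+ 2 :> R by rewrite mulr_ge0// sqr_ge0.
    by apply: ler_wpM2r => //; exact: divr_ge0.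
  rewrite /p exprMn.
  have -> : q ^+ (n./2).+2 = q ^+ n./2 * q ^+ 2 by rewrite -exprD addn2.
  rewrite [leRHS](_ : _ = (2 `^ (n%:R * B) * q ^+ n./2) * ((1 + 12 * eps2) ^+ (n./2).+2)
     * (q ^+ 2 / (64 * n%:R ^+ 2))); last by field; rewrite gt_eqF.
  rewrite [leLHS](_ : _ = 1 * n%:R ^+ 3 * (q ^+ 2 / (64 * n%:R ^+ 2))); last first.
    by field; rewrite gt_eqF.
  rewrite ler_wpM2r ?divr_ge0 ?sqr_ge0 ?mulr_ge0 ?sqr_ge0//.
  by rewrite ler_pM ?exprn_ge0 ?(ltW n0).
have a4 : 0 < q ^+ 2 * n%:R / 64 by rewrite divr_gt0// mulr_gt0// exprn_gt0.
apply: le_trans (expRN_le_inv (lt_le_trans a4 a3)) _.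
apply: (@le_trans _ _ (q ^+ 2 * n%:R / 64)^-1).
  by rewrite lef_pV2 ?posrE ?(lt_le_trans a4 a3).
rewrite (_ : (_)^-1 = 64 / q ^+ 2 / n%:R); last by field; rewrite !gt_eqF.
rewrite ler_wpM2l ?divr_ge0 ?sqr_ge0// lef_pV2 ?posrE//.
exact: ln_le_self.
Qed.

(** [N q^m] is at most [q^(-2)], and [m >= n / 4] gives [(1 - 8 eps2)^m <= exp (- 2 ln n) = n^(-2)].
    After the factor [n] of the cap bound there remains [1 / n], at most [1 / ln n]. *)
Lemma deviates_le :
  N%:R * (n%:R * (q * (1 - 8 * eps2)) ^+ (n - 3)./2) <= 1 / q ^+ 2 / ln n%:R.
Proof.
have Nle := codebook_size_le n B.
set m := (n - 3)./2; pose s1 : R := 1 - 8 * eps2.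
have s10 : 0 <= s1.
  by rewrite subr_ge0; apply: le_trans eps_le; rewrite ler_wpM2r// ler_nat.
have q1 : 0 <= q ^+ m by rewrite exprn_ge0// ltW.
have b1 : 2 `^ (n%:R * B) * q ^+ m <= (q ^+ 2)^-1.
  rewrite qX -powR_mulrn ?powR_ge0// -powRrM -powRN.
  apply: ler_powR; first by rewrite ler1n.
  rewrite (_ : - _ = 4 * B); last by ring.
  rewrite ler_wpM2r// lerBlDr -natrM -natrD ler_nat addnC.
  exact: leq_double_half_subn3.
have b2 : s1 ^+ m <= (n%:R ^+ 2)^-1.
  apply: (@le_trans _ _ (expR (- (8 * eps2) * m%:R))).
    rewrite expRM_natr lerXn2r ?nnegrE ?expR_ge0//.
    by rewrite /s1; have := expR_ge1Dx (- (8 * eps2)); lra.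
  rewrite -exp_ln -expRN ler_expR /eps2.
  have h : n%:R <= 4 * m%:R :> R by rewrite -natrM ler_nat leq_quadruple_half_subn3.
  rewrite mulNr lerN2.
  rewrite (_ : 8 * _ * _ = ln n%:R * 2 * (4 * m%:R / n%:R)); last first.
    by field; rewrite gt_eqF.
  by rewrite ler_peMr ?mulr_ge0 ?(ltW L0)// ler_pdivlMr// mul1r.
apply: (@le_trans _ _ (2 `^ (n%:R * B) * (n%:R * (q * s1) ^+ m))).
  by rewrite ler_wpM2r// mulr_ge0 ?(ltW n0)// exprn_ge0// mulr_ge0// ltW.
rewrite exprMn (_ : _ * (_ * _) = (2 `^ (n%:R * B) * q ^+ m) * (n%:R * s1 ^+ m)); last by ring.
apply: (@le_trans _ _ ((q ^+ 2)^-1 * (n%:R * (n%:R ^+ 2)^-1))).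
  apply: ler_pM => //; last by rewrite ler_wpM2l ?(ltW n0).
    by rewrite mulr_ge0// powR_ge0.
  by rewrite mulr_ge0 ?(ltW n0)// exprn_ge0.
rewrite mul1r ler_wpM2l ?invr_ge0 ?sqr_ge0//.
rewrite (_ : _ * _ = n%:R^-1); last by field; rewrite gt_eqF.
by rewrite lef_pV2 ?posrE//; exact: ln_le_self.
Qed.

End estimates.
End codebook_numerics.

Section good_event.
Variables (R : realType) (n N : nat) (sigma c B : R).
Hypotheses (sigma_gt0 : 0 < sigma) (c_gt0 : 0 < c) (n_gt0 : (0 < n)%N).
Implicit Types (x theta y : n.-tuple R).

Let nR : 0 < n%:R :> R. Proof. by rewrite ltr0n. Qed.
Let sn : 0 < Num.sqrt n%:R :> R. Proof. by rewrite sqrtr_gt0. Qed.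
Let sn2 : Num.sqrt n%:R ^+ 2 = n%:R :> R. Proof. by rewrite sqr_sqrtr// ltW. Qed.

Lemma magnitude_codebook_near (b0 : R) : 0 <= b0 -> b0 <= c ^+ 2 ->
  exists2 beta, magnitude_codebook n c beta & `|beta - b0| <= (Num.sqrt n%:R)^-1.
Proof.
move=> b00 b0c; set r := Num.sqrt n%:R; have r0 : 0 < r by exact: sn.
have cr : (0 < Num.ceil (c ^+ 2 * r))%R.
  by rewrite ceil_gt0 mulr_gt0// exprn_gt0.
(* The grid starts at [k = 1], so 0 is approximated by [1 / sqrt n]; any positive [b0] is rounded
   up, which stays within the grid because [b0 <= c^2]. *)
have [bz|bp] := eqVneq b0 0.
  exists (1 / r); last by rewrite bz subr0 mul1r ger0_norm// invr_ge0 ltW.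
  by exists 1%N; split=> //; rewrite -gtz0_ge1.
have {}bp : 0 < b0 by rewrite lt_neqAle eq_sym bp.
have br : (0 < Num.ceil (b0 * r))%R by rewrite ceil_gt0 mulr_gt0.
exists (`|Num.ceil (b0 * r)|%N%:R / r).
  exists `|Num.ceil (b0 * r)|%N; split => //.
    by rewrite absz_gt0 gt_eqF.
  by rewrite gez0_abs ?(ltW br)//; apply: Num.Theory.le_ceil; rewrite ler_wpM2r// ltW.
have -> : `|Num.ceil (b0 * r)|%N%:R = (Num.ceil (b0 * r))%:~R :> R.
  by rewrite pmulrn gez0_abs// ltW.
have h1 := ceil_ge (b0 * r); have h2 := ceilB1_lt (b0 * r).
rewrite ger0_norm; last by rewrite subr_ge0 ler_pdivlMr.
rewrite -(ler_pM2r r0) mulrBl divfK ?gt_eqF// mulVf ?gt_eqF//.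
by move: h2; rewrite intrD; lra.
Qed.

Lemma dotprod_shift theta x :
  dotprod theta x = dotprod theta theta +
    \sum_(i < n) tnth theta i * (tnth x i - tnth theta i).
Proof.
by rewrite /dotprod -big_split/=; apply: eq_bigr => i _; ring.
Qed.

Lemma enorm_shift theta x :
  enorm x ^+ 2 = dotprod theta theta + n%:R * sigma ^+ 2 +
    2 * \sum_(i < n) tnth theta i * (tnth x i - tnth theta i) +
    \sum_(i < n) ((tnth x i - tnth theta i) ^+ 2 - sigma ^+ 2).
Proof.
rewrite sumrB sumr_const card_ord mulr_natl.
rewrite addrA (addrAC (_ + _ *+ n)) (addrAC _ (sigma ^+ 2 *+ n)).
rewrite addrAC addrK enorm_sqr mulr_sumr /dotprod -!big_split/=.
by apply: eq_bigr => i _; ring.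
Qed.

Lemma distortion_decode theta y (b : R) :
  distortion theta (decode_estimate sigma B b y) =
  let w := Num.sqrt (n%:R * b ^+ 2 * (1 - 2 `^ (- 2 * B)) / (b + sigma ^+ 2)) in
  n%:R^-1 * (dotprod theta theta - 2 * w * dotprod theta y + w ^+ 2 * dotprod y y).
Proof.
set w := Num.sqrt _; rewrite /= /distortion; congr (_ * _).
rewrite (_ : [tuple _ | i < n] = [tuple tnth theta i - w * tnth y i | i < n]); last first.
  by apply: eq_from_tnth => i; rewrite !tnth_mktuple.
rewrite enorm_sqr dotprodBl ![dotprod _ (mktuple _)]dotprodC !dotprodBl.
by rewrite (dotprodC y theta); ring.
Qed.

Variables (t delta eps C : R) (k1 : R).
Let T : R := Num.sqrt (1 - 2 `^ (- 2 * B)).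
Hypotheses (B_ge0 : 0 <= B) (t_ge0 : 0 <= t)
  (k1_t : T - k1 * eps <= t) (delta_eps : delta <= 5 * eps)
  (eps_ge0 : 0 <= eps) (eps_le1 : eps <= 1) (eps_sigma : 6 * eps <= sigma ^+ 2)
  (eps_n : (Num.sqrt n%:R)^-1 <= eps).
Hypothesis bound : linear_distortion_bound sigma c T k1 5 C.

Lemma good_distortion theta x (Cb : N.-tuple (n.-tuple R)) (M : n.-tuple R) :
  enorm theta ^+ 2 / n%:R <= c ^+ 2 ->
  quantized_estimate sigma c B Cb x M ->
  `|\sum_(i < n) tnth theta i * (tnth x i - tnth theta i)| <= n%:R * eps ->
  `|\sum_(i < n) ((tnth x i - tnth theta i) ^+ 2 - sigma ^+ 2)| <= n%:R * eps ->
  ~ codebook_fails theta t delta (c * Num.sqrt n%:R) x Cb ->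
  distortion theta M <=
      sigma ^+ 2 * c ^+ 2 / (sigma ^+ 2 + c ^+ 2)
      + c ^+ 4 / (sigma ^+ 2 + c ^+ 2) * 2 `^ (- 2 * B) + C * eps.
Proof.
move=> thc [b [xc [[bcode bmin] [xcC xcmax] ->]]] A1 A2 nfail.
have [i0 xci] : exists i : 'I_N, xc = tnth Cb i by exact/tnthP.
have xcS : dotprod xc xc = 1.
  apply/usphereE; rewrite xci; apply: contrapT => h.
  by apply: nfail; apply: Or33; exists i0.
have txc : t * enorm x <= dotprod x xc.
  rewrite leNgt; apply/negP => h; apply: nfail; apply: Or31 => i.
  apply: le_lt_trans h; apply: xcmax => /=; exact: mem_tnth.
have dev : - (delta * (c * Num.sqrt n%:R) * enorm x ^+ 2) <=
    enorm x ^+ 2 * dotprod theta xc - dotprod theta x * dotprod x xc.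
  rewrite leNgt; apply/negP => h; apply: nfail; apply: Or32.
  by exists i0; rewrite -xci.
rewrite distortion_decode.
set wn := Num.sqrt (n%:R * _ * _ / _); rewrite /= xcS mulr1.
set A := \sum_(i < n) _ in A1; set Q := \sum_(i < n) _ in A2.
pose b0 := dotprod theta theta / n%:R; pose r := enorm x ^+ 2 / n%:R.
have rE : r - (b0 + sigma ^+ 2) = (2 * A + Q) / n%:R.
  by rewrite /r (enorm_shift theta x) -/A -/Q /b0; field; rewrite gt_eqF.
have AQ : `|(2 * A + Q) / n%:R| <= 3 * eps.
  rewrite normrM normfV [X in _ / X]gtr0_norm// ler_pdivrMr//.
  apply: le_trans (ler_normD _ _) _; rewrite normrM (@ger0_norm _ 2)//.
  by move: A1 A2; rewrite ![n%:R * _]mulrC; lra.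
have b00 : 0 <= b0 by rewrite divr_ge0 ?dotprod_ge0// ltW.
have b0c : b0 <= c ^+ 2 by rewrite /b0 -enorm_sqr.
have [beta betaC betab] := magnitude_codebook_near b00 b0c.
have bp : 0 < b.
  by case: bcode => k [k1' _ ->]; rewrite divr_gt0// ltr0n.
have rhat : n%:R^-1 * enorm x ^+ 2 - sigma ^+ 2 = b0 + (2 * A + Q) / n%:R.
  by rewrite -rE /r; ring.
(* The estimate of the squared magnitude is off by at most [3 eps]. Some grid point is within [eps]
   of [b0], hence within [4 eps] of the estimate; the selected [b] is no farther, and returning to
   [b0] costs [3 eps] again. *)
have bb : `|b - b0| <= 7 * eps.
  have := bmin _ betaC; rewrite rhat; set z := (2 * A + Q) / _ in AQ *.
  have -> : b - b0 = (b - (b0 + z)) + z by ring.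
  have bz : `|beta - (b0 + z)| <= eps + 3 * eps.
    have -> : beta - (b0 + z) = (beta - b0) - z by ring.
    exact: le_trans (ler_normB _ _) (lerD (le_trans betab eps_n) AQ).
  move=> h; apply: le_trans (ler_normD _ _) _.
  by have := lerD (le_trans h bz) AQ; lra.
have rr : `|r - (b0 + sigma ^+ 2)| <= 3 * eps by rewrite rE.
have s2 : 0 < sigma ^+ 2 by rewrite exprn_gt0.
have r0 : 0 < r.
  move: rr eps_sigma eps_ge0; rewrite ler_norml => /andP[+ _].
  by move: s2 b00; set S := sigma ^+ 2; lra.
have x2 : enorm x ^+ 2 = r * n%:R by rewrite /r divfK// gt_eqF.
have x0 : 0 < enorm x.
  by rewrite lt0r sqrtr_ge0 andbT -sqrf_eq0 x2 mulf_neq0// gt_eqF.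
have sr : Num.sqrt r = enorm x / Num.sqrt n%:R.
  apply/eqP; rewrite -(eqrXn2 (ltn0Sn 1)) ?sqrtr_ge0//; last first.
    by rewrite divr_ge0// ltW.
  by rewrite sqr_sqrtr ?(ltW r0)// expr_div_n sn2.
pose h := dotprod x xc / enorm x.
have th : t <= h by rewrite ler_pdivlMr.
have h1 : h <= 1.
  rewrite ler_pdivrMr// mul1r; have [d0|d0] := leP (dotprod x xc) 0.
    by apply: le_trans d0 (ltW x0).
  rewrite -ler_sqr ?nnegrE ?(ltW d0) ?(ltW x0)// enorm_sqr.
  by have := cauchy_schwarz x xc; rewrite xcS mulr1.
pose a := dotprod theta x / n%:R; pose g := dotprod theta xc / Num.sqrt n%:R.
have ab : `|a - b0| <= eps.
  rewrite (_ : a - b0 = A / n%:R); last first.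
    by rewrite /a dotprod_shift -/A /b0; field; rewrite gt_eqF.
  by rewrite normrM normfV [X in _ / X]gtr0_norm// ler_pdivrMr// mulrC.
have gh : a * h / Num.sqrt r - delta * c <= g.
  rewrite sr -(ler_pM2r (mulr_gt0 sn (exprn_gt0 2 x0))).
  rewrite (_ : g * _ = enorm x ^+ 2 * dotprod theta xc); last first.
    by rewrite /g; field; rewrite gt_eqF.
  rewrite (_ : _ * (_ * _) = dotprod theta x * dotprod x xc -
     delta * (c * Num.sqrt n%:R) * enorm x ^+ 2); first lra.
  rewrite /a /h; set k := Num.sqrt n%:R.
  have -> : n%:R = k ^+ 2 by rewrite sn2.
  by field; rewrite !gt_eqF.
pose w := wn / Num.sqrt n%:R.
have q1 : 0 <= 1 - 2 `^ (- 2 * B) :> R.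
  rewrite subr_ge0; apply: (@le_trans _ _ (2 `^ 0)); last by rewrite powRr0.
  by apply: ler_powR; [rewrite ler1n|rewrite mulNr oppr_le0 mulr_ge0].
have T2 : T ^+ 2 = 1 - 2 `^ (- 2 * B) by rewrite sqr_sqrtr.
have w0 : 0 <= w by rewrite divr_ge0 ?sqrtr_ge0.
have w2 : w ^+ 2 = b ^+ 2 * T ^+ 2 / (b + sigma ^+ 2).
  rewrite expr_div_n sqr_sqrtr ?sn2; last first.
    rewrite divr_ge0//; last by rewrite addr_ge0// ltW.
    by rewrite mulr_ge0// mulr_ge0 ?sqr_ge0// ltW.
  by rewrite T2; field; rewrite !gt_eqF// addr_gt0.
have := bound eps_ge0 eps_le1 eps_sigma b00 b0c bp bb rr ab th (le_trans t_ge0 th) h1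
  k1_t delta_eps gh w0 w2.
rewrite T2 opprB addrCA subrr addr0; apply: le_trans.
rewrite le_eqVlt; apply/orP; left; apply/eqP.
rewrite /b0 /w /g; clearbody wn; set k := Num.sqrt n%:R.
have -> : n%:R = k ^+ 2 by rewrite sn2.
by field; rewrite gt_eqF.
Qed.

End good_event.

(** * Probability of error *)

Section error_probability.
Variables (R : realType) (n : nat) (sigma c B : R).
Let q : R := 2 `^ (- 2 * B).
Let T : R := Num.sqrt (1 - q).
Let eps2 : R := ln n%:R / n%:R.
Let eps : R := Num.sqrt eps2.
Context (d : measure_display) (W : measurableType d) (P : probability W R)
  (theta : n.-tuple R) (X : {mfun W >-> n.-tuple R})
  (U : {mfun W >-> (codebook_size n B).-tuple (n.-tuple R)})
  (M : {mfun W >-> n.-tuple R}).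

Lemma error_probability_le (C : R) :
  0 < sigma -> 0 < c -> 0 < B -> (8 <= n)%N -> 1 <= ln n%:R :> R ->
  12 * eps2 <= 1 -> q * (1 + 12 * eps2) < 1 -> 36 * eps2 <= (sigma ^+ 2) ^+ 2 ->
  2 <= 2 `^ (n%:R * B) :> R ->
  enorm theta ^+ 2 / n%:R <= c ^+ 2 ->
  isotropic_gaussian P theta sigma X -> uniform_codebook P U ->
  independent_rv P X U ->
  (forall w, quantized_estimate sigma c B (U w) (X w) (M w)) ->
  linear_distortion_bound sigma c T (12 / T) 5 C ->
  (P [set w | (distortion theta (M w) >
      sigma ^+ 2 * c ^+ 2 / (sigma ^+ 2 + c ^+ 2)
      + c ^+ 4 / (sigma ^+ 2 + c ^+ 2) * q + C * eps)%R] <=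
   ((sigma ^+ 2 * c ^+ 2 + 33 * sigma ^+ 4 + 65 / q ^+ 2) / ln n%:R)%:E)%E.
Proof.
move=> s0 c0 B0 n8 L1 e12 qe e36 E2 thc XG [mu mu_u U_law] XU ME bound.
have n0 : (0 < n)%N by exact: leq_trans n8.
have nR : 0 < n%:R :> R by rewrite ltr0n.
have L0 : 0 < ln n%:R :> R by exact: lt_le_trans L1.
have e20 : 0 < eps2 by rewrite divr_gt0.
have e0 : 0 < eps by rewrite sqrtr_gt0.
have ee : eps ^+ 2 = eps2 by rewrite sqr_sqrtr// ltW.
have q0 : 0 < q by exact: powR_gt0.
have s2 : 0 < sigma ^+ 2 by rewrite exprn_gt0.
have e1 : eps <= 1.
  by rewrite -ler_sqr ?nnegrE ?(ltW e0)// ee expr1n; lra.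
have e6 : 6 * eps <= sigma ^+ 2.
  rewrite -ler_sqr ?nnegrE ?(ltW s2) ?mulr_ge0 ?(ltW e0)// exprMn ee.
  by rewrite (_ : 6 ^+ 2 = 36)//; ring.
have sn0 : 0 < Num.sqrt n%:R :> R by rewrite sqrtr_gt0.
have sn2 : Num.sqrt n%:R ^+ 2 = n%:R :> R by rewrite sqr_sqrtr// ltW.
have en : (Num.sqrt n%:R)^-1 <= eps.
  rewrite -ler_sqr ?nnegrE ?invr_ge0 ?(ltW e0) ?(ltW sn0)// ee exprVn sn2.
  by rewrite -[leLHS]mul1r ler_wpM2r// invr_ge0 ltW.
have qe0 : 0 < q * eps2 by rewrite mulr_gt0.
have q1 : q < 1 by lra.
have T2 : T ^+ 2 = 1 - q by rewrite sqr_sqrtr//; lra.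
have T0 : 0 < T by rewrite sqrtr_gt0; lra.
pose t : R := Num.sqrt (1 - q * (1 + 12 * eps2)).
have t2 : t ^+ 2 = 1 - q * (1 + 12 * eps2) by rewrite sqr_sqrtr//; lra.
have t0 : 0 < t by rewrite sqrtr_gt0; lra.
have t1 : t < 1.
  by rewrite -ltr_sqr ?nnegrE ?(ltW t0)// t2 expr1n; lra.
(* From [T^2 - t^2 = 12 q eps^2] and [T + t >= T]; positivity of [T] is where [B > 0] enters. *)
have tT : T - 12 / T * eps <= t.
  have [tT|tT] := leP T t.
    by apply: le_trans tT; rewrite gerBl mulr_ge0 ?divr_ge0 ?(ltW T0) ?(ltW e0).
  rewrite lerBlDr -lerBlDl mulrAC ler_pdivlMr//.
  apply: (@le_trans _ _ ((T - t) * (T + t))).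
    by rewrite ler_wpM2l ?subr_ge0 ?(ltW tT)// lerDl ltW.
  rewrite -subr_sqr T2 t2 -ee.
  have : q * eps ^+ 2 <= 1 * eps.
    by rewrite ler_pM ?(ltW q0) ?sqr_ge0 ?(ltW q1)// expr2 ler_piMl// ltW.
  by lra.
pose N := codebook_size n B.
have N0 : (0 < N)%N.
  have := codebook_size_ge E2; rewrite -/N => h.
  by rewrite -(ltr0n R); apply: lt_le_trans h; rewrite divr_gt0// powR_gt0.
pose delta : R := 5 * eps; have d0 : 0 <= delta by rewrite mulr_ge0 ?(ltW e0).
pose K : R := c * Num.sqrt n%:R; have K0 : 0 <= K by rewrite mulr_ge0// ltW.
have thK : dotprod theta theta <= K ^+ 2.
  by rewrite exprMn sn2 -ler_pdivrMr// -enorm_sqr.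
pose s : R := q * (1 - 8 * eps2).
have sp : 0 < s by rewrite mulr_gt0//; lra.
(* Amounts to [12 q + 8 q < 25], up to the factor [eps2], which holds as [q < 1]. *)
have ts : 1 - (t ^+ 2 + delta ^+ 2) < s.
  rewrite t2 /delta exprMn ee /s.
  have : q * eps2 < 1 * eps2 by rewrite ltr_pM2r.
  by rewrite (_ : 5 ^+ 2 = 25); [lra|ring].
have mn := double_half_subn3_le n8; have nj := leq_double_halfS n.
pose F := [set w | codebook_fails theta t delta K (X w) (U w)].
have mF : measurable F by exact: measurable_codebook_fails.
have PF : (P F <= (65 / q ^+ 2 / ln n%:R)%:E)%E.
  have := codebook_failure mu_u U_law XU N0 n0 t0 t1 d0 K0 thK sp ts mn nj.
  move=> /le_trans; apply; rewrite lee_fin t2.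
  have := misses_le (ltW B0) n8 L1 e12 E2.
  have := deviates_le (ltW B0) n8 L1 e12.
  rewrite -/q -/eps2 -/s -/N.
  rewrite (_ : 1 - (1 - _) = q * (1 + 12 * eps2)); last by ring.
  by rewrite ![_ / q ^+ 2 / _]mulrAC; lra.
(* The squared threshold [(n eps)^2] is [n ln n], against variances of order [n]: Chebyshev's
   inequality yields [O(1 / ln n)] for [A] and [Q]. *)
pose A := [set w | n%:R * eps <= `|\sum_(i < n) tnth theta i * (tnth (X w) i - tnth theta i)|].
pose Q := [set w | n%:R * eps <= `|\sum_(i < n) ((tnth (X w) i - tnth theta i) ^+ 2 - sigma ^+ 2)|].
have mX i : measurable_fun setT (fun w => tnth (X w) i - tnth theta i).
  by apply: measurable_funB => //; exact: measurableT_comp (measurable_tnth i) _.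
have mA : measurable A.
  apply: measurable_set_le => //; apply: measurableT_comp => //.
  by apply: measurable_sum => i; exact: measurable_funM.
have mQ : measurable Q.
  apply: measurable_set_le => //; apply: measurableT_comp => //.
  by apply: measurable_sum => i; apply: measurable_funB => //; exact: measurable_funX.
have ne0 : 0 < n%:R * eps by rewrite mulr_gt0.
have ne2 : (n%:R * eps) ^+ 2 = n%:R * ln n%:R.
  by rewrite exprMn ee /eps2; field; rewrite gt_eqF.
have PA : (P A <= (sigma ^+ 2 * c ^+ 2 / ln n%:R)%:E)%E.
  apply: le_trans (gaussian_linear_concentration s0 XG ne0) _.
  rewrite lee_fin ne2 ler_pdivrMr ?mulr_gt0//.
  rewrite (_ : _ / _ * _ = sigma ^+ 2 * (c ^+ 2 * n%:R)); last first.
    by field; rewrite gt_eqF.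
  by rewrite ler_wpM2l ?(ltW s2)// -ler_pdivrMr// -enorm_sqr.
have PQ : (P Q <= (33 * sigma ^+ 4 / ln n%:R)%:E)%E.
  apply: le_trans (gaussian_quadratic_concentration s0 XG ne0) _.
  rewrite lee_fin ne2 le_eqVlt; apply/orP; left; apply/eqP.
  by field; rewrite !gt_eqF.
apply: (@le_trans _ _ (P (A `|` Q `|` F))).
  apply: le_measure; rewrite ?inE//.
  - apply: measurable_set_lt => //; apply: measurable_funM => //.
    apply: measurable_funX; apply: measurable_enorm.
    apply/measurable_fun_tnthP => i.
    rewrite (_ : _ \o _ = fun w => tnth theta i - tnth (M w) i); last first.
      by apply/funext => w /=; rewrite tnth_mktuple.
    by apply: measurable_funB => //; exact: measurableT_comp (measurable_tnth i) _.
  - by apply: measurableU => //; exact: measurableU.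
  move=> w /=; apply: contraPP => /not_orP[/not_orP[nA nQ] nF].
  apply/negP; rewrite -leNgt.
  apply: (good_distortion s0 c0 n0 (ltW B0) (ltW t0) tT (lexx _) (ltW e0) e1 e6 en
    bound thc (ME w) _ _ nF).
    by rewrite leNgt; apply/negP => /ltW.
  by rewrite leNgt; apply/negP => /ltW.
apply: le_trans (measureU2 P (measurableU _ _ mA mQ) mF) _.
rewrite [X in (_ <= X%:E)%E]mulrDl EFinD; apply: leeD; last exact: PF.
apply: le_trans (measureU2 P mA mQ) _.
by rewrite mulrDl EFinD; exact: leeD.
Qed.

End error_probability.

(** * Asymptotics in n and conclusion *)

Section asymptotics.
Variable R : realType.

(** [ln n = 2 ln (sqrt n) <= 2 sqrt n], so the quotient is at most [2 / sqrt n]. *)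
Lemma ln_div_le (n : nat) (eta : R) : 0 < eta -> (2 / eta) ^+ 2 <= n%:R ->
  (0 < n)%N -> ln n%:R / n%:R <= eta.
Proof.
move=> eta0 nlarge n0; have nR : 0 < n%:R :> R by rewrite ltr0n.
set r := Num.sqrt n%:R : R; have r0 : 0 < r by rewrite sqrtr_gt0.
have rr : n%:R = r ^+ 2 by rewrite sqr_sqrtr// ltW.
have r2 : 2 / eta <= r.
  by rewrite -ler_sqr ?nnegrE ?divr_ge0 ?(ltW eta0) ?(ltW r0)// -rr.
rewrite rr lnXn// ler_pdivrMr ?exprn_gt0// -mulr_natr.
have := ln_le_self r0; rewrite ler_pdivrMr// in r2.
by rewrite expr2 => h; nra.
Qed.

Lemma ln_large (A : R) : \forall n \near \oo, A <= ln n%:R.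
Proof.
near=> n; have nA : expR A <= n%:R by near: n; exact: nbhs_infty_ger.
have n0 : 0 < n%:R :> R by apply: lt_le_trans nA; exact: expR_gt0.
by rewrite -ler_expR lnK.
Unshelve. all: by end_near. Qed.

Lemma cvg_div_ln (K : R) : (fun n => (K / ln n%:R)%:E) @ \oo --> 0%E.
Proof.
apply: cvg_EFin; first by near=> n.
apply/cvgrPdist_le => e e0; near=> n.
have L : (`|K| + 1) / e <= ln n%:R by near: n; exact: ln_large.
have L0 : 0 < ln n%:R :> R.
  by apply: lt_le_trans L; rewrite divr_gt0// ltr_wpDl.
rewrite sub0r normrN /= normrM normfV [`|ln _|]gtr0_norm// ler_pdivrMr//.
by move: L; rewrite ler_pdivrMr// mulrC; lra.
Unshelve. all: by end_near. Qed.

End asymptotics.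

Theorem corollary3p2 (R : realType) (sigma c B : R)
  (sigma_gt0 : 0 < sigma) (c_gt0 : 0 < c) (B_ge0 : 0 <= B)
  (theta : forall n : nat, n.-tuple R)
  (theta_le : forall n : nat, (0 < n)%N -> enorm (theta n) ^+ 2 / n%:R <= c ^+ 2)
  (d : nat -> measure_display) (T : forall n : nat, measurableType (d n))
  (P : forall n : nat, probability (T n) R)
  (X : forall n : nat, {mfun T n >-> n.-tuple R})
  (U : forall n : nat, {mfun T n >-> (codebook_size n B).-tuple (n.-tuple R)})
  (M : forall n : nat, {mfun T n >-> n.-tuple R})
  (X_gaussian : forall n : nat, (0 < n)%N ->
     isotropic_gaussian (P n) (theta n) sigma (X n))
  (U_uniform : forall n : nat, (0 < n)%N -> uniform_codebook (P n) (U n))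
  (XU_independent : forall n : nat, (0 < n)%N ->
     independent_rv (P n) (X n) (U n))
  (M_estimate : forall n : nat, (0 < n)%N -> forall w : T n,
     quantized_estimate sigma c B (U n w) (X n w) (M n w)) :
  exists C' : R,
    (fun n : nat => P n [set w : T n |
       distortion (theta n) (M n w) >
         sigma ^+ 2 * c ^+ 2 / (sigma ^+ 2 + c ^+ 2)
         + c ^+ 4 / (sigma ^+ 2 + c ^+ 2) * 2 `^ (- 2 * B)
         + C' * Num.sqrt (ln n%:R / n%:R)]) @ \oo --> 0%E.
Proof.
have s2 : 0 < sigma ^+ 2 by rewrite exprn_gt0.
have c2 : 0 < c ^+ 2 by rewrite exprn_gt0.
(* For [B = 0] one has [q = 1], and [1 - q (1 + 12 eps2)] is not positive, so no threshold [t] is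
   available. The estimate is then the zero vector, and its distortion [|theta|^2 / n] is at most
   [c^2], which is exactly the bound with [C' = 0]. *)
have [B0|B0] := eqVneq B 0.
  exists 0; apply: cvg_near_cst; near=> n.
  have n0 : (0 < n)%N by near: n; exact: nbhs_infty_gt.
  rewrite [X in P n X](_ : _ = set0) ?measure0//.
  apply/seteqP; split => // w /=; apply/negP; rewrite -leNgt.
  have [b [xc [_ _ ->]]] := M_estimate n n0 w.
  rewrite distortion_decode /= B0 mulr0 powRr0 subrr mulr0 mul0r sqrtr0.
  rewrite mulr0 mul0r subr0 expr0n mul0r addr0 mul0r addr0 mulr1.
  rewrite mulrC -enorm_sqr; apply: le_trans (theta_le n n0) _.
  rewrite le_eqVlt; apply/orP; left; apply/eqP.
  by field; rewrite gt_eqF// addr_gt0.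
have {}B0 : 0 < B by rewrite lt_neqAle eq_sym B0.
pose q : R := 2 `^ (- 2 * B).
have q0 : 0 < q by exact: powR_gt0.
have q1 : q < 1.
  rewrite /q mulNr powRN invf_lt1 ?powR_gt0//.
  rewrite /powR pnatr_eq0/= expR_gt1 mulr_gt0 ?mulr_gt0//.
  by rewrite ln_gt0// ltr1n.
have T0 : 0 <= Num.sqrt (1 - q) by exact: sqrtr_ge0.
have T1 : Num.sqrt (1 - q) <= 1.
  by rewrite -ler_sqr ?nnegrE// expr1n sqr_sqrtr; lra.
have k10 : 0 <= 12 / Num.sqrt (1 - q) by rewrite divr_ge0.
have [C bound] := distortion_bound sigma_gt0 c_gt0 T0 T1 k10 (ler0n R 5).
exists C.
apply: (@squeeze_cvge _ _ _ _ (fun=> 0%E) _ (fun n =>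
  ((sigma ^+ 2 * c ^+ 2 + 33 * sigma ^+ 4 + 65 / q ^+ 2) / ln n%:R)%:E)); last 2 first.
- exact: cvg_cst.
- exact: cvg_div_ln.
near=> n; apply/andP; split; first exact: measure_ge0.
have n8 : (8 <= n)%N by near: n; exact: nbhs_infty_ge.
have n0 : (0 < n)%N by exact: leq_trans n8.
have small (eta : R) : 0 < eta -> (2 / eta) ^+ 2 <= n%:R -> ln n%:R / n%:R <= eta.
  by move=> eta0 h; exact: ln_div_le.
apply: error_probability_le => //.
- by near: n; exact: ln_large.
- rewrite mulrC -ler_pdivlMr//; apply: small => //.
  by near: n; exact: nbhs_infty_ger.
- have h : 0 < (1 - q) / (24 * q) by rewrite divr_gt0 ?subr_gt0 ?mulr_gt0.
  have : ln n%:R / n%:R <= (1 - q) / (24 * q).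
    by apply: small => //; near: n; exact: nbhs_infty_ger.
  by rewrite -/q ler_pdivlMr ?mulr_gt0//; lra.
- rewrite mulrC -ler_pdivlMr//; apply: small; first by rewrite divr_gt0// exprn_gt0.
  by near: n; exact: nbhs_infty_ger.
- have nB : 1 <= n%:R * B.
    by rewrite -ler_pdivrMr//; near: n; exact: nbhs_infty_ger.
  apply: (@le_trans _ _ (2 `^ 1)); first by rewrite powRr1.
  by apply: ler_powR => //; rewrite ler1n.
- exact: theta_le.
- exact: X_gaussian.
- exact: U_uniform.
- exact: XU_independent.
- exact: M_estimate.
Unshelve. all: by end_near. Qed.
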